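(* Let $\alpha,\beta\in[0,1)$ with not both $\alpha$ and $\beta$ in $\{0,\frac12\}$, and let $N\ge1$. Then $\sigma(\mathcal{L}_N^{(\alpha,\beta)})=S_1\sqcup S_2\sqcup S_3$ (pairwise disjoint union), where $S_1=\{\lambda\in\mathbb R\setminus\mathcal E(\alpha,\beta): R(\alpha,\beta,\lambda)\in\sigma(\mathcal{L}_{N-1}^{(\alpha_\downarrow(\alpha,\beta,\lambda),\beta_\downarrow(\alpha,\beta,\lambda))})\}$, $S_2=\{\lambda\in\mathbb R:\mathcal D(\beta,\lambda)=0 \text{ and } \lambda \text{ is an eigenvalue of } \mathcal{L}_N^{(\alpha,\beta)}\}$, $S_3=\{\frac32\}$ if $\alpha=0$, $S_3=\{\frac12\}$ if $\alpha=\frac12$, and $S_3=\emptyset$ otherwise. Moreover, each $\lambda\in S_1$ has multiplicity $\mathrm{mult}(\mathcal{L}_{N-1}^{(\alpha_\downarrow(\alpha,\beta,\lambda),\beta_\downarrow(\alpha,\beta,\lambda))},R(\alpha,\beta,\lambda))$ in $\sigma(\mathcal{L}_N^{(\alpha,\beta)})$, and $\lambda\in S_3$ has multiplicity $\frac{3^N+3}{2}$.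
   Context: Sierpinski gasket graphs: let $x_0=(0,0)$, $x_1=(\frac12,\frac{\sqrt3}{2})$, $x_2=(1,0)$, $\Phi_i(x)=\frac12(x-x_i)+x_i$; $\mathfrak G_0$ is the complete graph on $\{x_0,x_1,x_2\}$, $\mathfrak G_N=\bigcup_{i}\Phi_i(\mathfrak G_{N-1})$, $G_N=2^N\mathfrak G_N$ with vertex set $V_N$ (edges of length 1, $G_{N-1}\subset G_N$, $|V_N|=\frac{3^{N+1}+3}{2}$), a subgraph of the triangular lattice $\mathbb T$. A unitary connection assigns to each oriented edge $xy$ a unit complex number $\omega_{xy}$ with $\omega_{yx}=\overline{\omega_{xy}}$. For $\alpha,\beta\in[0,1)$, $\mathcal{L}_N^{(\alpha,\beta)}u(x)=\sum_{y\sim x}\frac{1}{\deg_{G_N}(x)}(u(x)-\omega_{xy}u(y))$ on $L^2(V_N,\deg_{G_N})$, where $\omega$ is the restriction to $G_N$ of a unitary connection on $\mathbb T$ with holonomy $e^{2\pi i\alpha}$ around every upward unit triangle and $e^{2\pi i\beta}$ around every downward unit triangle (both traversed counterclockwise); unique up to gauge. $\sigma$ denotes the spectrum (eigenvalues) and $\mathrm{mult}(\mathcal L,\lambda)$ the multiplicity ($0$ if $\lambda\notin\sigma(\mathcal L)$). Functions: $A(\alpha,\beta,\lambda)=16\lambda^2-(32+4\cos2\pi\alpha)\lambda+15+4\cos2\pi\alpha+\cos(2\pi(\alpha+\beta))$; $\mathcal D(\beta,\lambda)=-\lambda^3+3\lambda^2-\frac{45}{16}\lambda+\frac{13}{16}-\frac1{32}\cos2\pi\beta$;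 $\Psi(\alpha,\beta,\lambda)=(1-\lambda)^2-\frac1{16}+\frac{1-\lambda}{4}(2e^{-2\pi i\alpha}+e^{-2\pi i(2\alpha+\beta)})+\frac1{16}(e^{-4\pi i\alpha}+2e^{-2\pi i(\alpha+\beta)})$; $R(\alpha,\beta,\lambda)=1+\frac{A(\alpha,\beta,\lambda)-64\mathcal D(\beta,\lambda)(1-\lambda)}{16|\Psi(\alpha,\beta,\lambda)|}$; $\theta(\alpha,\beta,\lambda)=\frac{\arg\Psi(\alpha,\beta,\lambda)}{2\pi}$ with $\arg\in[0,2\pi)$; $\alpha_\downarrow=3\alpha+\beta+3\theta \pmod 1$; $\beta_\downarrow=3\beta+\alpha-3\theta\pmod 1$; exceptional set $\mathcal E(\alpha,\beta)=\{\lambda\in\mathbb R:\Psi(\alpha,\beta,\lambda)=0\text{ or }\mathcal D(\beta,\lambda)=0\}$. *)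

(* Defs.v *)
(* R : realType (mathcomp-analysis, for cos/sin/pi),
   complex numbers R[i] from mathcomp-real-closed. *)
From HB Require Import structures.
From mathcomp Require Import all_boot all_order all_algebra.
From mathcomp Require Import all_classical all_reals.
From mathcomp Require Import trigo.
From mathcomp Require Import complex.
Set Implicit Arguments. Unset Strict Implicit. Unset Printing Implicit Defensive.
Import Order.TTheory GRing.Theory Num.Theory.
Local Open Scope ring_scope.
Local Open Scope complex_scope.

(* ---------- Sierpinski gasket graphs G_N in lattice coordinates ----------
   A point (a,b) stands for a*e1 + b*e2 with e1 = (1,0), e2 = (1/2, sqrt3/2).
   Thus x0 = (0,0), x2 = e1 = (1,0), x1 = e2 = (0,1) in these coordinates,
   and G_N = 2^N G_N-frak is the union of G_{N-1}, G_{N-1} + 2^{N-1} x2 and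
   G_{N-1} + 2^{N-1} x1 (since 2^N Phi_i(y) = 2^{N-1} y + 2^{N-1} x_i). *)

Fixpoint inV (N : nat) (p : nat * nat) : bool :=
  match N with
  | 0 => (p.1 + p.2 <= 1)%N
  | M.+1 => [|| inV M p,
                (2 ^ M <= p.1)%N && inV M (p.1 - 2 ^ M, p.2)%N
              | (2 ^ M <= p.2)%N && inV M (p.1, p.2 - 2 ^ M)%N]
  end.

(* edge relation of G_N (G_0 is the complete graph on {x0,x1,x2}) *)
Fixpoint adjG (N : nat) (p q : nat * nat) : bool :=
  match N with
  | 0 => [&& inV 0 p, inV 0 q & p != q]
  | M.+1 => [|| adjG M p q,
                [&& (2 ^ M <= p.1)%N, (2 ^ M <= q.1)%N &
                    adjG M (p.1 - 2 ^ M, p.2)%N (q.1 - 2 ^ M, q.2)%N]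
              | [&& (2 ^ M <= p.2)%N, (2 ^ M <= q.2)%N &
                    adjG M (p.1, p.2 - 2 ^ M)%N (q.1, q.2 - 2 ^ M)%N]]
  end.

(* vertex set V_N as a finite type *)
Definition VT (N : nat) : finType :=
  {p : 'I_(2 ^ N).+1 * 'I_(2 ^ N).+1 | inV N (nat_of_ord p.1, nat_of_ord p.2)}.

Definition vcoord (N : nat) (x : VT N) : nat * nat :=
  (nat_of_ord (val x).1, nat_of_ord (val x).2).

Definition vadj (N : nat) (x y : VT N) : bool := adjG N (vcoord x) (vcoord y).

Definition vdeg (N : nat) (x : VT N) : nat := #|[set y | vadj x y]|.

(* lattice point (in the triangular lattice T) of a vertex *)
Definition vlat (N : nat) (x : VT N) : int * int :=
  ((vcoord x).1%:Z, (vcoord x).2%:Z).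

Section Complex.
Variable R : realType.
Local Notation C := R[i].

(* e^{i t} *)
Definition expi (t : R) : C := Complex (cos t) (sin t).

(* ---------- unitary connections on the triangular lattice ---------- *)
Definition tadj (p q : int * int) : bool :=
  let d := (q.1 - p.1, q.2 - p.2) in
  d \in [:: (1, 0); (0, 1); (-1, 1); (-1, 0); (0, -1); (1, -1)].

Definition shift (p : int * int) (a b : int) : int * int := (p.1 + a, p.2 + b).

(* omega is a unitary connection on T with holonomy e^{2 pi i a} around every
   upward unit triangle and e^{2 pi i b} around every downward unit triangle
   (counterclockwise; holonomy = product of omega along the oriented cycle). *)
Definition is_connection (a b : R) (omega : int * int -> int * int -> C) : Prop :=
  (forall x y, tadj x y -> `|omega x y| = 1 /\ omega y x = (omega x y)^*) /\
  (forall p, omega p (shift p 1 0) * omega (shift p 1 0) (shift p 0 1)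
             * omega (shift p 0 1) p = expi (2 * pi * a)) /\
  (forall p, omega (shift p 1 0) (shift p 1 1) * omega (shift p 1 1) (shift p 0 1)
             * omega (shift p 0 1) (shift p 1 0) = expi (2 * pi * b)).

(* matrix of L_N u(x) = sum_{y ~ x} (u(x) - omega_xy u(y)) / deg(x),
   indexed through an enumeration of V_N *)
Definition Lmx (N : nat) (omega : int * int -> int * int -> C)
  : 'M[C]_#|{: VT N}| :=
  \matrix_(i, j)
    let x := enum_val i in let y := enum_val j in
    ((i == j)%:R - (if vadj x y then omega (vlat x) (vlat y) / (vdeg x)%:R else 0)).

(* mathcomp's eigenvalue/eigenspace use row vectors (v *m g = a v); we apply
   them to the transpose so that they concern the operator u |-> Lmx *m u. *)
Definition in_spec (N : nat) omega (z : C) : Prop := eigenvalue (Lmx N omega)^T z.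
Definition mult (N : nat) omega (z : C) : nat := \rank (eigenspace (Lmx N omega)^T z).

(* ---------- the functions of the statement ---------- *)
Definition Af (a b l : R) : R :=
  16 * l ^+ 2 - (32 + 4 * cos (2 * pi * a)) * l + 15 + 4 * cos (2 * pi * a)
  + cos (2 * pi * (a + b)).

Definition Df (b l : R) : R :=
  - l ^+ 3 + 3 * l ^+ 2 - 45 / 16 * l + 13 / 16 - 1 / 32 * cos (2 * pi * b).

Definition Psi (a b l : R) : C :=
  ((1 - l) ^+ 2 - 1 / 16)%:C
  + ((1 - l) / 4)%:C * (2 * expi (- (2 * pi * a)) + expi (- (2 * pi * (2 * a + b))))
  + (1 / 16)%:C * (expi (- (4 * pi * a)) + 2 * expi (- (2 * pi * (a + b)))).

Definition Rf (a b l : R) : R :=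
  1 + (Af a b l - 64 * Df b l * (1 - l)) / (16 * complex.Re `|Psi a b l|).

(* argument in [0, 2 pi) (arbitrary value 0 for z = 0) *)
Definition carg (z : C) : R :=
  xget 0 [set t : R | 0 <= t < 2 * pi /\ z = `|z| * expi t].

Definition theta (a b l : R) : R := carg (Psi a b l) / (2 * pi).

Definition frac (x : R) : R := x - (Num.floor x)%:~R.

Definition adown (a b l : R) : R := frac (3 * a + b + 3 * theta a b l).
Definition bdown (a b l : R) : R := frac (3 * b + a - 3 * theta a b l).

Definition Eset (a b l : R) : Prop := Psi a b l = 0 \/ Df b l = 0.

End Complex.

(* Main.v *)
Require Import Defs.
From HB Require Import structures.
From mathcomp Require Import all_boot all_order all_algebra.
From mathcomp Require Import all_classical all_reals.
From mathcomp Require Import trigo.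
From mathcomp Require Import complex.
From mathcomp Require Import zify ring lra.
Import Order.TTheory GRing.Theory Num.Theory.
Local Open Scope ring_scope.
Local Open Scope complex_scope.

(** Split the vertices of [G_N] into the coarse ones (even coordinates) and the
    edge midpoints.  Each up-triangle of [G_(N-1)] carries three midpoints, joined
    among themselves in a triangle of flux [beta], and on them [L_N - l] is a 3x3
    matrix of determinant [Df beta l].  When this is nonzero the midpoint values
    are determined by the corner values, and eliminating them (a Schur complement)
    turns [L_N u = l u] into
      [deg x * (64 Df (1 - l) - Af) * u x = 16 * sum_y (transport x y * Psi^{+-}) * u y]
    over the neighbours [y] of [x] in [G_(N-1)], where [Psi^{+-}] is [Psi] or its
    conjugate according to the orientation of the edge.  If [Psi <> 0], its phase
    is absorbed in a new unitary connection with fluxes [adown], [bdown], and one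
    reads off the eigenvalue equation of [L_(N-1)] at [Rf].  If [Psi = 0], the
    unknown [e^{-2 pi i beta}] can be eliminated from [Psi = conj Psi = 0], leaving
    [(s^2 - 1) (s + 2 cos 2 pi alpha)^2 = 0] with [s = 4 (1 - l)]; apart from zeros
    of [Df] this only leaves [alpha in {0, 1/2}] and [l = 3/2, 1/2], where the
    coarse equation is void and the eigenspace has dimension [|V_(N-1)|]. *)

Set Implicit Arguments.
Unset Strict Implicit.
Unset Printing Implicit Defensive.

(** * Elimination of the midpoints in one cell *)

Section Cell.
Variable F : fieldType.
Implicit Types s a b w f m : F.
Local Ltac nz := repeat (apply/andP; split); by rewrite ?mulf_neq0 ?expf_neq0 ?oppr_eq0 ?oner_neq0.

(* Throughout, [s = 4 (1 - l)], [a = e^{-2 pi i alpha}], [b = e^{-2 pi i beta}]; then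
   [mid_det] is [64 Df] and [psi_poly] is [16 Psi].  The edges [w1 .. w6] run
   counterclockwise along the boundary P0 - m1 - P1 - m3 - P2 - m2 - P0 of a cell with
   corners P0, P1, P2; rotating the arguments by two gives the other corners. *)
Definition mid_det s b := s ^+ 3 - 3 * s - b - b^-1.
Definition psi_poly s a b := s ^+ 2 - 1 + s * (2 * a + a ^+ 2 * b) + a ^+ 2 + 2 * a * b.

(** Cramer's rule for the midpoint [m1]: the coefficients are cofactors of the 3x3 midpoint matrix,
    and the three brackets are the corner contributions received at [m1], [m3] and [m2], transported
    along the boundary to P0. *)
Definition midval s a b (w1 w2 w5 w6 f0 f1 f2 : F) :=
  w1^-1 * ((s ^+ 2 - 1) * (f0 + w1 * w2 * f1)
   + (s * a + a * b) * (w1 * w2 * f1 + (w5 * w6)^-1 * f2 / (a ^+ 3 * b))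
   + (s / a + (a * b)^-1) * (f0 + (w5 * w6)^-1 * f2)) / mid_det s b.

(** The inner edges are written through the boundary ones, since each corner triangle of the cell
    has holonomy [a^-1]. *)
Definition mideq s a (w1 w2 w3 w6 f0 f1 m1 m2 m3 : F) :=
  s * m1 = w1^-1 * f0 + w2 * f1 + a * w2 * w3 * m3 + a^-1 * w1^-1 * w6^-1 * m2.

Lemma mideq_val s a b w1 w2 w3 w4 w5 w6 f0 f1 f2 m1 m2 m3 :
  a != 0 -> b != 0 -> w1 != 0 -> w2 != 0 -> w3 != 0 -> w4 != 0 -> w5 != 0 ->
  w6 != 0 -> w1 * w2 * w3 * w4 * w5 * w6 = (a ^+ 3 * b)^-1 -> mid_det s b != 0 ->
  mideq s a w1 w2 w3 w6 f0 f1 m1 m2 m3 ->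
  mideq s a w3 w4 w5 w2 f1 f2 m3 m1 m2 ->
  mideq s a w5 w6 w1 w4 f2 f0 m2 m3 m1 ->
  m1 = midval s a b w1 w2 w5 w6 f0 f1 f2.
Proof.
move=> a0 b0 n1 n2 n3 n4 n5 n6 hw D0 E1 E2 E3.
apply: (mulIf D0); rewrite /midval divfK//.
apply: (mulfI n1).
have hb : b = (a ^+ 3 * (w1 * w2 * w3 * w4 * w5 * w6))^-1.
  by rewrite hw; field; nz.
rewrite /mideq in E1 E2 E3.
(* The three equations are weighted by the cofactors, so that only [mid_det] times [m1] remains. *)
transitivity ((s^+2 - 1) * (w1 * (s * m1 - a * w2 * w3 * m3 - a^-1 * w1^-1 * w6^-1 * m2))
  + (s * a + a * b) * (w1 * w2 * w3 * (s * m3 - a * w4 * w5 * m2 - a^-1 * w3^-1 * w2^-1 * m1))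
  + (s / a + (a * b)^-1) * (w6^-1 * (s * m2 - a * w6 * w1 * m1 - a^-1 * w5^-1 * w4^-1 * m3))).
  rewrite /mid_det hb; field; nz.
rewrite E1 E2 E3 hb; field; nz.
Qed.

Lemma val_mideq s a b w1 w2 w3 w4 w5 w6 f0 f1 f2 :
  a != 0 -> b != 0 -> w1 != 0 -> w2 != 0 -> w3 != 0 -> w4 != 0 -> w5 != 0 ->
  w6 != 0 -> w1 * w2 * w3 * w4 * w5 * w6 = (a ^+ 3 * b)^-1 -> mid_det s b != 0 ->
  mideq s a w1 w2 w3 w6 f0 f1
   (midval s a b w1 w2 w5 w6 f0 f1 f2) (midval s a b w5 w6 w3 w4 f2 f0 f1)
   (midval s a b w3 w4 w1 w2 f1 f2 f0).
Proof.
move=> a0 b0 n1 n2 n3 n4 n5 n6 hw D0.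
(* Solving the flux relation for [w6] keeps [b] free, so that the condition left by [field] is the
   nonvanishing [D2]. *)
have hb : w6 = (a ^+ 3 * (w1 * w2 * w3 * w4 * w5 * b))^-1.
  apply: (mulfI (mulf_neq0 (mulf_neq0 (mulf_neq0 (mulf_neq0 n1 n2) (mulf_neq0 n3 n4)) n5) b0)).
  transitivity (b * (w1 * w2 * w3 * w4 * w5 * w6)); first ring.
  by rewrite hw; field; nz.
have D1 : b * mid_det s b = b * s ^+ 3 - 3 * s * b - b ^+ 2 - 1.
  by rewrite /mid_det; field; nz.
have D2 : b * s ^+ 3 - 3 * s * b - b ^+ 2 - 1 != 0 by rewrite -D1 mulf_neq0.
rewrite /mideq /midval.
have -> : mid_det s b = (b * s ^+ 3 - 3 * s * b - b ^+ 2 - 1) / b.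
  by rewrite -D1 mulrAC divff// mul1r.
rewrite hb; field; nz.
Qed.

(** Seen from P0, the corner P1 is reached counterclockwise and collects [psi_poly]; P2 is reached
    clockwise and collects it at the inverse phases, which is the conjugate value for real [s] and
    unit [a], [b]. *)
Lemma corner_sum s a b w1 w2 w3 w4 w5 w6 f0 f1 f2 :
  a != 0 -> b != 0 -> w1 != 0 -> w2 != 0 -> w3 != 0 -> w4 != 0 -> w5 != 0 ->
  w6 != 0 -> w1 * w2 * w3 * w4 * w5 * w6 = (a ^+ 3 * b)^-1 -> mid_det s b != 0 ->
  mid_det s b * (w1 * midval s a b w1 w2 w5 w6 f0 f1 f2
     + w6^-1 * midval s a b w5 w6 w3 w4 f2 f0 f1) =
  (2 * (s ^+ 2 - 1) + s * (a + a^-1) + a * b + (a * b)^-1) * f0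
  + psi_poly s a b * (w1 * w2 * f1) + psi_poly s a^-1 b^-1 * ((w5 * w6)^-1 * f2).
Proof.
move=> a0 b0 n1 n2 n3 n4 n5 n6 hw D0.
rewrite /midval.
set X := (X in w1 * (X / _)); set Y := (X in w6^-1 * (X / _)).
have -> : mid_det s b * (w1 * (X / mid_det s b) + w6^-1 * (Y / mid_det s b)) = w1 * X + w6^-1 * Y.
  by field; nz.
have hb : b = (a ^+ 3 * (w1 * w2 * w3 * w4 * w5 * w6))^-1.
  by rewrite hw; field; nz.
rewrite /X/Y/psi_poly hb; field; nz.
Qed.

Lemma rmorph_psi_poly (f : {rmorphism F -> F}) s a b :
  f (psi_poly s a b) = psi_poly (f s) (f a) (f b).
Proof.
by rewrite /psi_poly !(rmorphB, rmorphN, rmorphD, rmorphM, rmorphXn, rmorph1, rmorph_nat).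
Qed.

Lemma psi_poly_eq0 s a b : a != 0 -> b != 0 -> 2 + a != 0 -> a != 2 ->
  mid_det s b != 0 -> psi_poly s a b = 0 -> psi_poly s a^-1 b^-1 = 0 ->
  (a = 1 \/ a = - 1) /\ s = - 2 * a.
Proof.
move=> a0 b0 a2 a2' D0 P1 P2.
have Q1 : b * (a * (s * a + 2)) = - ((s + a) ^+ 2 - 1).
  by apply/eqP; rewrite -subr_eq0 -P1 /psi_poly; apply/eqP; ring.
have Q2 : b * ((a * s + 1) ^+ 2 - a ^+ 2) = - (s + 2 * a).
  apply/eqP; rewrite -subr_eq0 -(mulr0 (a ^+ 2 * b)) -P2 /psi_poly; apply/eqP.
  by field; nz.
(* [Q1] and [Q2] are both linear in [b]; cross-multiplying them eliminates it. *)
have : (s ^+ 2 - 1) * (s * a + (a ^+ 2 + 1)) ^+ 2 = 0.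
  transitivity ((s + a)^+2 * ((a * s + 1) ^+ 2 - a ^+ 2) - ((a * s + 1) ^+ 2 - a ^+ 2)
    - (s + 2 * a) * (a * (s * a + 2))); first ring.
  apply: (mulfI b0).
  transitivity (((s + a)^+2 - 1) * (b * ((a * s + 1) ^+ 2 - a ^+ 2))
    - (s + 2 * a) * (b * (a * (s * a + 2)))); first ring.
  by rewrite Q1 Q2; ring.
have D1 : b * mid_det s b = b * s ^+ 3 - 3 * s * b - b ^+ 2 - 1.
  by rewrite /mid_det; field; nz.
have D2 : b * s ^+ 3 - 3 * s * b - b ^+ 2 - 1 != 0 by rewrite -D1 mulf_neq0.
move/eqP; rewrite mulf_eq0 expf_eq0 /= (_ : s^+2 - 1 = (s-1) * (s+1)); last ring.
rewrite mulf_eq0 subr_eq0 => /orP [/orP [] /eqP hs|/eqP hs].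
(* Here [b = -1], and in the next case [s = -1] one gets [b = 1]; both are zeros of [mid_det]. *)
- have : (a * (2 + a)) * (b + 1) = 0.
    transitivity (b * (a * (s * a + 2)) + ((s + a) ^+ 2 - 1)); first by rewrite hs; ring.
    by rewrite Q1; ring.
  move/eqP; rewrite !mulf_eq0 (negbTE a0) (negbTE a2) /= => /eqP hb.
  by move/eqP: D2; case; rewrite hs (_ : b = -1); [ring | apply/eqP; rewrite -addr_eq0 hb].
- have {}hs : s = -1 by apply/eqP; rewrite -addr_eq0 hs.
  have : (a * (2 - a)) * (b - 1) = 0.
    transitivity (b * (a * (s * a + 2)) + ((s + a) ^+ 2 - 1)); first by rewrite hs; ring.
    by rewrite Q1; ring.
  move/eqP; rewrite !mulf_eq0 (negbTE a0) subr_eq0 eq_sym (negbTE a2') /= subr_eq0 => /eqP hb.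
  by move/eqP: D2; case; rewrite hs hb; ring.
- have {}hs : s = - a - a^-1.
    by apply: (mulIf a0); apply/eqP; rewrite -subr_eq0 -hs; apply/eqP; field; nz.
  (* The alternative [b = - a^-3] is excluded because [s^3 - 3 s = - (a^3 + a^-3)] makes [mid_det]
     vanish. *)
  have : (1 - a ^+ 2) * (b * a ^+ 3 + 1) = 0.
    transitivity (a ^+ 2 * (b * (a * (s * a + 2)) + ((s + a) ^+ 2 - 1))).
      by rewrite hs; field; nz.
    by rewrite Q1; ring.
  move/eqP; rewrite mulf_eq0 => /orP [ha|/eqP hb]; last first.
    move/eqP: D2; case.
    have -> : b = - (a ^+ 3)^-1.
      by apply: (mulIf (expf_neq0 3 a0)); apply/eqP; rewrite -subr_eq0 -hb; apply/eqP; field; nz.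
    by rewrite hs; field; nz.
  move: ha; rewrite (_ : 1 - a ^+ 2 = - ((a - 1) * (a + 1))); last ring.
  rewrite oppr_eq0 mulf_eq0 subr_eq0 addr_eq0 => /orP [] /eqP ha; split.
  + by left.
  + by rewrite hs ha; field; nz.
  + by right.
  + by rewrite hs ha; field; nz.
Qed.
End Cell.

(** * Cells and adjacency of the gasket graphs *)

(* [cell N x y]: [(x, y)] is the lower left corner of an upward unit triangle of [G_N]. *)
Fixpoint cell (N : nat) (x y : int) : bool :=
  match N with
  | 0 => (x == 0) && (y == 0)
  | M.+1 => [|| cell M x y, cell M (x - (2 ^ M)%:Z) y | cell M x (y - (2 ^ M)%:Z)]
  end.

Lemma cell_bound N x y : cell N x y -> [&& 0 <= x, 0 <= y & x + y < (2 ^ N)%:Z].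
Proof.
elim: N x y => [|N IH] x y /=; first by lia.
by rewrite expnS => /or3P[] /IH; lia.
Qed.

Lemma cell_neg N x y : (x < 0) || (y < 0) -> cell N x y = false.
Proof. by move=> h; apply/negP => /cell_bound; lia. Qed.

(** Passes from gluing three copies to subdividing: each cell of [G_N], doubled, splits into three
    upward cells at its corners and a downward triangle in the middle. It holds because doubling
    commutes with the shifts of the recursion. *)
Lemma cell_double N x y :
  [/\ cell N.+1 (2 * x) (2 * y) = cell N x y,
      cell N.+1 (2 * x + 1) (2 * y) = cell N x y,
      cell N.+1 (2 * x) (2 * y + 1) = cell N x y &
      cell N.+1 (2 * x + 1) (2 * y + 1) = false].
Proof.
elim: N x y => [|N IH] x y; first by rewrite /=; split; lia.
have E M u v : cell M.+1 u v =
  [|| cell M u v, cell M (u - (2 ^ M)%:Z) v | cell M u (v - (2 ^ M)%:Z)] by [].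
rewrite !(E N.+1) (E N x).
have h (u : int) : 2 * u - (2 ^ N.+1)%:Z = 2 * (u - (2 ^ N)%:Z) by rewrite expnS; lia.
have h1 (u : int) : 2 * u + 1 - (2 ^ N.+1)%:Z = 2 * (u - (2 ^ N)%:Z) + 1.
  by rewrite expnS; lia.
rewrite !h !h1.
by case: (IH x y) (IH (x - (2 ^ N)%:Z) y) (IH x (y - (2 ^ N)%:Z)) =>
  -> -> -> -> [-> -> -> ->] [-> -> -> ->].
Qed.

Lemma inVE N (a b : nat) :
  inV N (a, b) = [|| cell N a b, cell N (a%:Z - 1) b | cell N a (b%:Z - 1)].
Proof.
elim: N a b => [|N IH] a b /=; first by lia.
have H1 : (2 ^ N <= a)%N && inV N ((a - 2 ^ N)%N, b) =
  [|| cell N (a%:Z - (2 ^ N)%:Z) b, cell N (a%:Z - 1 - (2 ^ N)%:Z) b |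
      cell N (a%:Z - (2 ^ N)%:Z) (b%:Z - 1)].
  (* When the truncated subtraction would be wrong, the shifted cells have a negative coordinate and
     are absent. *)
  case: leqP => h /=; last by rewrite !cell_neg //; lia.
  by rewrite IH -subzn// (addrAC a%:Z _ (-1)).
have H2 : (2 ^ N <= b)%N && inV N (a, (b - 2 ^ N)%N) =
  [|| cell N a (b%:Z - (2 ^ N)%:Z), cell N (a%:Z - 1) (b%:Z - (2 ^ N)%:Z) |
      cell N a (b%:Z - 1 - (2 ^ N)%:Z)].
  case: leqP => h /=; last by rewrite !cell_neg //; lia.
  by rewrite IH -subzn// (addrAC b%:Z _ (-1)).
rewrite IH H1 H2.
by do 9! case: (cell _ _ _).
Qed.

(* Every edge lies in exactly one upward triangle, and its direction tells which one. *)
Definition edge N (p q : int * int) : bool :=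
  [|| ((q == (p.1 + 1, p.2)) || (q == (p.1, p.2 + 1))) && cell N p.1 p.2,
      ((q == (p.1 - 1, p.2)) || (q == (p.1 - 1, p.2 + 1))) && cell N (p.1 - 1) p.2 |
      ((q == (p.1, p.2 - 1)) || (q == (p.1 + 1, p.2 - 1))) && cell N p.1 (p.2 - 1)].

Lemma orb3_andb (s1 s2 s3 c1 c2 c3 d1 d2 d3 e1 e2 e3 : bool) :
  [|| [|| s1 && c1, s2 && c2 | s3 && c3], [|| s1 && d1, s2 && d2 | s3 && d3]
    | [|| s1 && e1, s2 && e2 | s3 && e3]] =
  [|| s1 && [|| c1, d1 | e1], s2 && [|| c2, d2 | e2] | s3 && [|| c3, d3 | e3]].
Proof.
by rewrite !andb_orr (orbACA (s1 && d1)) (orbACA (s2 && d2)) (orbACA (s1 && c1))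
  (orbACA (s2 && c2)).
Qed.

Lemma adjGE N (a b c d : nat) :
  adjG N (a, b) (c, d) = edge N (a%:Z, b%:Z) (c%:Z, d%:Z).
Proof.
elim: N a b c d => [|N IH] a b c d; first by rewrite /edge /= !xpair_eqE; lia.
have H1 : [&& (2 ^ N <= a)%N, (2 ^ N <= c)%N &
    adjG N ((a - 2 ^ N)%N, b) ((c - 2 ^ N)%N, d)] =
    edge N (a%:Z - (2 ^ N)%:Z, b%:Z) (c%:Z - (2 ^ N)%:Z, d%:Z).
  rewrite IH; case: leqP => h /=; last first.
    by rewrite /edge/= !xpair_eqE !(@cell_neg N (a%:Z - _)) ?(@cell_neg N (a%:Z - _ - 1)) //; lia.
  case: leqP => h' /=; first by rewrite -!subzn.
  apply/esym/negP; rewrite /edge /= !xpair_eqE.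
  by move=> /or3P[] /andP[+ /cell_bound]; lia.
have H2 : [&& (2 ^ N <= b)%N, (2 ^ N <= d)%N &
    adjG N (a, (b - 2 ^ N)%N) (c, (d - 2 ^ N)%N)] =
    edge N (a%:Z, b%:Z - (2 ^ N)%:Z) (c%:Z, d%:Z - (2 ^ N)%:Z).
  rewrite IH; case: leqP => h /=; last first.
    by rewrite /edge/= !xpair_eqE !(@cell_neg N _ (b%:Z - _)) ?(@cell_neg N _ (b%:Z - _ - 1)) //; lia.
  case: leqP => h' /=; first by rewrite -!subzn.
  apply/esym/negP; rewrite /edge /= !xpair_eqE.
  by move=> /or3P[] /andP[+ /cell_bound]; lia.
rewrite [LHS]/= H1 H2 IH /edge /= !xpair_eqE.
have S (u v k e : int) : (u - k == v - k + e) = (u == v + e) by lia.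
have S0 (u v k : int) : (u - k == v - k) = (u == v) by lia.
rewrite !S !S0 !(addrAC _ (-1) (- (2 ^ N)%:Z)).
exact: orb3_andb.
Qed.

Lemma edge_sym N p q : edge N p q = edge N q p.
Proof.
case: p q => x y [u v]; apply/idP/idP; rewrite /edge /= => /or3P[] /andP[/orP[] /eqP[-> ->]];
 rewrite ?addrK ?subrK !xpair_eqE !eqxx /= => ->; rewrite ?orbT //; lia.
Qed.

Lemma edge_inV N p q : edge N p q ->
  exists a b, [/\ q = (a%:Z, b%:Z), inV N (a, b) & (a <= 2 ^ N)%N && (b <= 2 ^ N)%N].
Proof.
case: p q => x y [u v]; rewrite edge_sym /edge /= => h.
have : [|| cell N u v, cell N (u - 1) v | cell N u (v - 1)].
  by case/or3P: h => /andP[_ ->]; rewrite ?orbT.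
move=> H; have B : [&& 0 <= u, 0 <= v, u <= (2 ^ N)%:Z & v <= (2 ^ N)%:Z].
  by clear h; case/or3P: H => /cell_bound /and3P[? ? ?]; lia.
case: u v H B {h} => [a|//] [b|] H B; last by lia.
by exists a, b; rewrite inVE H; split=> //; lia.
Qed.

Arguments cell : simpl never.

(** * Eigenvectors as functions on the lattice *)

Lemma vlat_inj N : injective (@vlat N).
Proof.
move=> x y [h1 h2]; apply: val_inj.
by rewrite [LHS]surjective_pairing [RHS]surjective_pairing; congr pair; apply: val_inj.
Qed.

Lemma vlat_inV N (x : VT N) :
  exists a b : nat, vlat x = (a%:Z, b%:Z) /\ inV N (a, b).
Proof. by exists (vcoord x).1, (vcoord x).2; split=> //; exact: (valP x). Qed.

Lemma vlat_surj N a b : inV N (a, b) -> (a <= 2 ^ N)%N && (b <= 2 ^ N)%N ->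
  exists x : VT N, vlat x = (a%:Z, b%:Z).
Proof.
move=> h /andP[ha hb].
by exists (exist (fun p : 'I_(2 ^ N).+1 * 'I_(2 ^ N).+1 => inV N (nat_of_ord p.1, nat_of_ord p.2))
  (Ordinal (ha : a < (2 ^ N).+1)%N, Ordinal (hb : b < (2 ^ N).+1)%N) h).
Qed.

Lemma vadjE N (x y : VT N) : vadj x y = edge N (vlat x) (vlat y).
Proof. by rewrite /vadj [vcoord x]surjective_pairing [vcoord y]surjective_pairing adjGE. Qed.

Section Row.
Variable F : numFieldType.
Implicit Types (f g : int * int -> F) (p q : int * int).

(** Neighbours are grouped by the upward cells that contain [p], each giving its two other corners;
    in this form [cell_double] applies directly. *)
Definition nbsum N g p : F :=
  (cell N p.1 p.2)%:R * (g (p.1 + 1, p.2) + g (p.1, p.2 + 1))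
  + (cell N (p.1 - 1) p.2)%:R * (g (p.1 - 1, p.2) + g (p.1 - 1, p.2 + 1))
  + (cell N p.1 (p.2 - 1))%:R * (g (p.1, p.2 - 1) + g (p.1 + 1, p.2 - 1)).

Definition ncell N p : F :=
  (cell N p.1 p.2)%:R + (cell N (p.1 - 1) p.2)%:R + (cell N p.1 (p.2 - 1))%:R.

Lemma nbsum1 N p : nbsum N (fun=> 1) p = 2 * ncell N p.
Proof. by rewrite /nbsum /ncell; ring. Qed.

Lemma sum_edge N (x : VT N) g q (c : bool) : (c -> edge N (vlat x) q) ->
  \sum_(y : VT N) (c && (vlat y == q))%:R * g q = c%:R * g q.
Proof.
case: c => [/(_ isT)|_]; last by rewrite big1 ?mul0r // => y _; rewrite mul0r.
move=> /edge_inV[a [b [-> hV hb]]]; have [y0 hy0] := vlat_surj hV hb.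
rewrite (bigD1 y0) //= hy0 eqxx big1 ?addr0// => y hy.
by rewrite -hy0 (inj_eq (@vlat_inj N)) (negbTE hy) mul0r.
Qed.

(** The six lattice directions are distinct, so at most one term survives. *)
Lemma edge_split N p q g : (if edge N p q then g q else 0) =
  (cell N p.1 p.2 && (q == (p.1 + 1, p.2)))%:R * g (p.1 + 1, p.2)
  + (cell N p.1 p.2 && (q == (p.1, p.2 + 1)))%:R * g (p.1, p.2 + 1)
  + (cell N (p.1 - 1) p.2 && (q == (p.1 - 1, p.2)))%:R * g (p.1 - 1, p.2)
  + (cell N (p.1 - 1) p.2 && (q == (p.1 - 1, p.2 + 1)))%:R * g (p.1 - 1, p.2 + 1)
  + (cell N p.1 (p.2 - 1) && (q == (p.1, p.2 - 1)))%:R * g (p.1, p.2 - 1)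
  + (cell N p.1 (p.2 - 1) && (q == (p.1 + 1, p.2 - 1)))%:R * g (p.1 + 1, p.2 - 1).
Proof.
rewrite /edge; case: p => x y /=; move: (cell _ _ _) (cell _ _ _) (cell _ _ _) => c1 c2 c3.
do 6![case: eqVneq => [->|_];
  first by do ?match goal with |- context [@eq_op ?T (?a, ?b) (?c, ?d)] =>
      have -> : @eq_op T (a, b) (c, d) = false by rewrite xpair_eqE; lia end;
    rewrite /= ?andbF ?orbF ?andbT; case: c1; case: c2; case: c3; rewrite /=; ring].
by rewrite /= !andbF !mulr0n; ring.
Qed.

Lemma edge_steps N p :
  [/\ (cell N p.1 p.2 -> edge N p (p.1 + 1, p.2)) /\
       (cell N p.1 p.2 -> edge N p (p.1, p.2 + 1)),
      (cell N (p.1 - 1) p.2 -> edge N p (p.1 - 1, p.2)) /\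
       (cell N (p.1 - 1) p.2 -> edge N p (p.1 - 1, p.2 + 1)) &
      (cell N p.1 (p.2 - 1) -> edge N p (p.1, p.2 - 1)) /\
       (cell N p.1 (p.2 - 1) -> edge N p (p.1 + 1, p.2 - 1))].
Proof. by split; split=> h; rewrite /edge h !eqxx ?orbT. Qed.

Lemma sum_vadj N (x : VT N) g :
  \sum_(y : VT N) (if vadj x y then g (vlat y) else 0) = nbsum N g (vlat x).
Proof.
under eq_bigr => y _ do rewrite vadjE edge_split.
rewrite !big_split /nbsum !mulrDr !addrA.
by congr (_ + _ + _ + _ + _ + _); apply: (@sum_edge _ x);
  case: (edge_steps N (vlat x)) => [[? ?] [? ?] [? ?]].
Qed.

Lemma vdegE N (x : VT N) : (vdeg x)%:R = 2 * ncell N (vlat x) :> F.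
Proof.
rewrite -nbsum1 -sum_vadj -big_mkcond /= sumr_const /vdeg.
by congr (_%:R); apply: eq_card => y; rewrite inE.
Qed.

Definition rowf N f : 'rV[F]_#|{: VT N}| := \row_i f (vlat (enum_val i)).

(** Extension by zero off [V_N]; together with [rowf] it lets eigenvectors be handled as functions
    on the whole lattice. *)
Definition funof N (u : 'rV[F]_#|{: VT N}|) p : F :=
  \sum_i u 0 i * (vlat (enum_val i) == p)%:R.

Lemma funof_vlat N u i : funof u (@vlat N (enum_val i)) = u 0 i.
Proof.
rewrite /funof (bigD1 i)//= eqxx mulr1 big1 ?addr0// => j hj.
by rewrite (inj_eq (@vlat_inj N)) (inj_eq enum_val_inj) (negbTE hj) mulr0.
Qed.

Lemma rowfK N u : rowf N (funof u) = u.
Proof. by apply/rowP => i; rewrite mxE funof_vlat. Qed.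

Lemma rowf_eq N f g :
  (forall x : VT N, f (vlat x) = g (vlat x)) <-> rowf N f = rowf N g.
Proof.
split=> [h|h x]; first by apply/rowP => i; rewrite !mxE h.
by move/rowP: h => /(_ (enum_rank x)); rewrite !mxE enum_rankK.
Qed.

Lemma ncell_gt0 N (x : VT N) : 0 < ncell N (vlat x).
Proof.
have [a [b [-> h]]] := vlat_inV x; move: h; rewrite inVE /ncell -!natrD ltr0n /=.
by do 3!case: (cell _ _ _).
Qed.

Lemma ncell_eq0 N p : (forall x : VT N, vlat x <> p) ->
  [/\ cell N p.1 p.2 = false, cell N (p.1 - 1) p.2 = false & cell N p.1 (p.2 - 1) = false].
Proof.
case: p => u v h; suff: ~~ [|| cell N u v, cell N (u - 1) v | cell N u (v - 1)].
  by rewrite !negb_or => /and3P[/negbTE-> /negbTE-> /negbTE->].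
apply/negP => H; have : exists q, edge N (u, v) q.
  case: (edge_steps N (u, v)) => [[h1 _] [h2 _] [h3 _]].
  by case/or3P: H; [move/h1|move/h2|move/h3] => ?; eexists; eassumption.
case=> q; rewrite edge_sym => /edge_inV[a [b [E hV hb]]].
by have [x hx] := vlat_surj hV hb; apply: (h x); rewrite E.
Qed.

End Row.

(** * Eigenspaces through lattice functions, and reality of the spectrum *)

Section Spectrum.
Variable R : realType.
Local Notation C := R[i].
Implicit Types (om : int * int -> int * int -> C) (f : int * int -> C).

(** The eigenvalue equation multiplied by the degree [2 * ncell]. Quantifying over all lattice
    points adds nothing: off [V_N] both sides vanish. *)
Definition eigfun N om (z : C) f := forall p,
  2 * ncell C N p * (1 - z) * f p = nbsum N (fun q => om p q * f q) p.

Lemma eigenspace_rowf N om z f :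
  (rowf N f <= eigenspace (Lmx N om)^T z)%MS <-> eigfun N om z f.
Proof.
have E (x : VT N) : \sum_(y : VT N) (if vadj x y then om (vlat x) (vlat y) * f (vlat y) else 0)
    = nbsum N (fun q => om (vlat x) q * f q) (vlat x) by rewrite -(sum_vadj x).
have M i : (rowf N f *m (Lmx N om)^T) 0 i = f (vlat (enum_val i)) -
    nbsum N (fun q => om (vlat (enum_val i)) q * f q) (vlat (enum_val i)) / (2 * ncell C N (vlat (enum_val i))).
  rewrite mxE -E -vdegE; set x := enum_val i.
  under eq_bigr => j _ do rewrite !mxE mulrBr.
  rewrite sumrB; congr (_ - _).
    rewrite (bigD1 i)//= eqxx mulr1 big1 ?addr0// => j /negbTE hj.
    by rewrite eq_sym hj mulr0.
  rewrite mulr_suml [RHS](reindex _ (onW_bij _ (enum_val_bij _))) /=.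
  apply: eq_bigr => j _; case: ifP => _; last by rewrite mulr0 mul0r.
  by rewrite mulrCA mulrA.
split=> [/eigenspaceP h p|h].
  have [[x hx]|hp] := pselect (exists x : VT N, vlat x = p).
    have := M (enum_rank x); rewrite h !mxE enum_rankK hx => h'.
    have n0 : 2 * ncell C N p != 0 by rewrite -hx mulf_neq0 ?pnatr_eq0 ?gt_eqF ?ncell_gt0.
    by rewrite -mulrA mulrBl mul1r h' opprB addrC subrK mulrC divfK.
  have [|h1 h2 h3] := @ncell_eq0 N p; first by move=> x hx; apply: hp; exists x.
  by rewrite /nbsum /ncell h1 h2 h3 !addr0 !mul0r !addr0 mulr0 !mul0r.
apply/eigenspaceP/rowP => i; rewrite M -h !mxE.
have n0 : 2 * ncell C N (vlat (enum_val i)) != 0.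
  by rewrite mulf_neq0 ?pnatr_eq0 ?gt_eqF ?ncell_gt0.
by rewrite -(mulrA (2 * _)) mulrAC divff// mul1r; ring.
Qed.

Lemma unit_conj (w : C) : `|w| = 1 -> w^* = w^-1.
Proof. by move=> h; rewrite invC_norm h expr1n invr1 mul1r. Qed.

Lemma edge_tadj N p q : edge N p q -> tadj p q.
Proof.
case: p q => x y [u v]; rewrite /edge /tadj /= !xpair_eqE !inE !xpair_eqE /=.
by case/or3P => /andP[+ _]; lia.
Qed.

(** The operator is self-adjoint for the degree-weighted inner product: [d i * L i j] is Hermitian,
    so the form [Q] is real, and on an eigenvector it is [z] times the positive number [S]. *)
Lemma spec_real N om z : (forall p q, tadj p q -> `|om p q| = 1 /\ om q p = (om p q)^*) ->
  in_spec N om z -> exists l : R, z = l%:C.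
Proof.
move=> hom /eigenvalueP[u hu u0].
pose d (i : 'I_#|{: VT N}|) : C := (vdeg (enum_val i : VT N))%:R.
have d0 i : 0 < d i by rewrite /d vdegE mulr_gt0 ?ltr0n ?ncell_gt0.
have dc i : ((d i)^*)%R = d i by rewrite /d conjC_nat.
pose L := Lmx N om.
have Lc i j : ((d i * L i j)^*)%R = d j * L j i.
  rewrite rmorphM /= dc !mxE /= !mulrBr rmorphB mulrBr rmorph_nat.
  congr (_ - _).
    by rewrite eq_sym; case: eqVneq => [->|]; rewrite ?mulr0.
  have -> : vadj (enum_val j : VT N) (enum_val i) = vadj (enum_val i : VT N) (enum_val j).
    by rewrite !vadjE edge_sym.
  case: ifP => [|_]; last by rewrite rmorph0 !mulr0.
  rewrite vadjE => /edge_tadj /hom[_ ->].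
  rewrite rmorphM /= fmorphV /= -/(d i) -/(d j) dc !mulrA (mulrAC (d i)) divff ?gt_eqF//.
  by rewrite (mulrAC (d j)) divff ?gt_eqF.
pose Q := \sum_i \sum_j ((u 0 i)^*)%R * (d i * L i j) * u 0 j.
have Qc : (Q^*)%R = Q.
  rewrite /Q rmorph_sum exchange_big /=; apply: eq_bigr => j _.
  rewrite rmorph_sum; apply: eq_bigr => i _.
  by rewrite rmorphM rmorphM /= Lc conjCK; ring.
pose S := \sum_i ((u 0 i)^*)%R * u 0 i * d i.
have S0 : 0 < S.
  have hpos i : 0 <= ((u 0 i)^*)%R * u 0 i * d i by rewrite mulr_ge0 ?(ltW (d0 i))// mulrC mul_conjC_ge0.
  have [i hi] : exists i, u 0 i != 0.
    by apply/existsP; apply: contraR u0 => /existsPn h; apply/eqP/rowP => i; apply/eqP; rewrite mxE -[_ == _]negbK h.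
  rewrite /S (bigD1 i)//= ltr_pwDl ?sumr_ge0//.
  by rewrite mulr_gt0// mulrC mul_conjC_gt0.
have QS : Q = z * S.
  rewrite /Q /S mulr_sumr; apply: eq_bigr => i _.
  have := congr1 (fun v : 'rV_ _ => v 0 i) hu; rewrite !mxE => hui.
  transitivity (((u 0 i)^*)%R * d i * \sum_j u 0 j * L i j).
    by rewrite mulr_sumr; apply: eq_bigr => j _; ring.
  rewrite (eq_bigr (fun j => u 0 j * (Lmx N om)^T j i)) ?hui; first by ring.
  by move=> j _; rewrite [(_^T) _ _]mxE.
have Sc : (S^*)%R = S by apply: conj_Creal; apply: gtr0_real.
have : (z^*)%R = z.
  by apply: (mulIf (lt0r_neq0 S0)); rewrite -QS -Qc QS rmorphM /= Sc.
by move/CrealP/RRe_real=> <-; exists (complex.Re z).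
Qed.
End Spectrum.

(** * Renormalization of the eigenvalue equation *)

Section Renorm.
Variable R : realType.
Local Notation C := R[i].
Implicit Types (om : int * int -> int * int -> C) (f : int * int -> C) (p q : int * int).
Local Ltac nz := repeat (apply/andP; split); by rewrite ?mulf_neq0 ?expf_neq0 ?oppr_eq0 ?oner_neq0
  ?invr_eq0.

(** A purely algebraic form of [is_connection], with [a] and [b] the inverse holonomies; unit
    modulus is weakened to invertibility so that [field] can work. *)
Definition fluxes (a b : C) om : Prop :=
  [/\ forall p q, tadj p q -> om p q * om q p = 1,
      forall x y, om (x, y) (x + 1, y) * om (x + 1, y) (x, y + 1) * om (x, y + 1) (x, y) = a^-1 &
      forall x y, om (x + 1, y) (x + 1, y + 1) * om (x + 1, y + 1) (x, y + 1)
                  * om (x, y + 1) (x + 1, y) = b^-1].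

Definition dbl p : int * int := (2 * p.1, 2 * p.2).

(* The factor is [z] along the counterclockwise directions of upward triangles. *)
Definition coarse om (z : C) p q : C :=
  let d := (q.1 - p.1, q.2 - p.2) in
  let m := (2 * p.1 + d.1, 2 * p.2 + d.2) in
  om (dbl p) m * om m (dbl q) * (if d \in [:: (1, 0); (-1, 1); (0, -1)] then z else z^-1).

Lemma fluxes_inv a b om p q : fluxes a b om -> tadj p q -> om q p = (om p q)^-1.
Proof.
case=> H _ _ h; have E := H _ _ h.
have n0 : om p q != 0 by apply: contra_eq_neq E => ->; rewrite mul0r eq_sym oner_neq0.
by apply: (mulfI n0); rewrite E mulfV.
Qed.

Lemma fluxes_neq0 a b om p q : fluxes a b om -> tadj p q -> om p q != 0.
Proof.
case=> H _ _ h; have E := H _ _ h.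
by apply: contra_eq_neq E => ->; rewrite mul0r eq_sym oner_neq0.
Qed.

Lemma tadj_steps x y :
  [/\ tadj (x, y) (x + 1, y), tadj (x, y) (x, y + 1) & tadj (x + 1, y) (x, y + 1)] /\
  [/\ tadj (x + 1, y) (x, y), tadj (x, y + 1) (x, y) & tadj (x, y + 1) (x + 1, y)].
Proof. by split; split; rewrite /tadj /= !inE !xpair_eqE /=; lia. Qed.

(* The six boundary edges of the side-2 triangle based at [(x, y)] determine
   the three inner ones. *)
Lemma cell_edges a b om (x y : int) : a != 0 -> b != 0 -> fluxes a b om ->
  let P0 := (x, y) in let P1 := (x + 1 + 1, y) in let P2 := (x, y + 1 + 1) in
  let m1 := (x + 1, y) in let m2 := (x, y + 1) in let m3 := (x + 1, y + 1) in
  let w1 := om P0 m1 in let w2 := om m1 P1 in let w3 := om P1 m3 in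
  let w4 := om m3 P2 in let w5 := om P2 m2 in let w6 := om m2 P0 in
  [/\ [/\ w1 != 0, w2 != 0 & w3 != 0] /\ [/\ w4 != 0, w5 != 0 & w6 != 0],
   [/\ om m1 P0 = w1^-1, om P1 m1 = w2^-1 & om m3 P1 = w3^-1]
     /\ [/\ om P2 m3 = w4^-1, om m2 P2 = w5^-1 & om P0 m2 = w6^-1],
   [/\ om m1 m2 = a^-1 * w1^-1 * w6^-1, om m3 m1 = a^-1 * w3^-1 * w2^-1 &
       om m2 m3 = a^-1 * w5^-1 * w4^-1],
   [/\ om m2 m1 = a * w6 * w1, om m1 m3 = a * w2 * w3 &
       om m3 m2 = a * w4 * w5] &
   w1 * w2 * w3 * w4 * w5 * w6 = (a ^+ 3 * b)^-1].
Proof.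
move=> a0 b0 H P0 P1 P2 m1 m2 m3 w1 w2 w3 w4 w5 w6.
have I := fluxes_inv H; have Z := fluxes_neq0 H.
have [[t01 t02 t12] [t10 t20 t21]] := tadj_steps x y.
have [[u01 u02 u12] [u10 u20 u21]] := tadj_steps (x + 1) y.
have [[v01 v02 v12] [v10 v20 v21]] := tadj_steps x (y + 1).
have n1 : w1 != 0 by exact: Z.
have n2 : w2 != 0 by exact: Z.
have n3 : w3 != 0 by exact: Z.
have n4 : w4 != 0 by exact: Z.
have n5 : w5 != 0 by exact: Z.
have n6 : w6 != 0 by exact: Z.
case: (H) => _ U D.
have e12 : om m1 m2 = a^-1 * w1^-1 * w6^-1.
  rewrite -(U x y) -/P0 -/m1 -/m2 -/w1 -/w6; field; nz.
have e31 : om m3 m1 = a^-1 * w3^-1 * w2^-1.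
  rewrite -(U (x + 1) y) -/m1 -/P1 -/m3 -/w2 -/w3; field; nz.
have e23 : om m2 m3 = a^-1 * w5^-1 * w4^-1.
  rewrite -(U x (y + 1)) -/m2 -/P2 -/m3 -/w4 -/w5; field; nz.
have e21 : om m2 m1 = a * w6 * w1.
  rewrite (I m1 m2)// e12; field; nz.
have e13 : om m1 m3 = a * w2 * w3.
  rewrite (I m3 m1) ?e31; last exact: u20.
  by field; nz.
have e32 : om m3 m2 = a * w4 * w5.
  rewrite (I m2 m3) ?e23; last exact: v01.
  by field; nz.
split=> //.
- by split; split; apply: I.
- have := D x y; rewrite -/m1 -/m2 -/m3 e21 e13 e32 => E.
  rewrite invfM -E; field; nz.
Qed.

Lemma coarse_steps om z x y :
  let P0 := (2 * x, 2 * y) in let P1 := (2 * x + 1 + 1, 2 * y) in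
  let P2 := (2 * x, 2 * y + 1 + 1) in
  let m1 := (2 * x + 1, 2 * y) in let m2 := (2 * x, 2 * y + 1) in
  let m3 := (2 * x + 1, 2 * y + 1) in
  [/\ coarse om z (x, y) (x + 1, y) = om P0 m1 * om m1 P1 * z,
      coarse om z (x + 1, y) (x, y + 1) = om P1 m3 * om m3 P2 * z &
      coarse om z (x, y + 1) (x, y) = om P2 m2 * om m2 P0 * z] /\
  [/\ coarse om z (x + 1, y) (x, y) = om P1 m1 * om m1 P0 / z,
      coarse om z (x, y + 1) (x + 1, y) = om P2 m3 * om m3 P1 / z &
      coarse om z (x, y) (x, y + 1) = om P0 m2 * om m2 P2 / z].
Proof.
have K (u : int) : [/\ 2 * (u + 1) = 2 * u + 1 + 1, u + 1 - u = 1, u - (u + 1) = -1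
    & u - u = 0] by split; lia.
have [Ex1 Ex2 Ex3 Ex4] := K x; have [Ey1 Ey2 Ey3 Ey4] := K y.
by split; split; rewrite /coarse /dbl /= !(Ex1, Ex2, Ex3, Ex4, Ey1, Ey2, Ey3, Ey4) ?addr0 ?addrK.
Qed.

(** Every lattice edge, or its reverse, is a counterclockwise side of an upward triangle. *)
Lemma tadj_cases p q : tadj p q -> exists x y,
  [\/ (p, q) = ((x, y), (x + 1, y)), (p, q) = ((x + 1, y), (x, y + 1)) |
      (p, q) = ((x, y + 1), (x, y))] \/
  [\/ (q, p) = ((x, y), (x + 1, y)), (q, p) = ((x + 1, y), (x, y + 1)) |
      (q, p) = ((x, y + 1), (x, y))].
Proof.
case: p q => x y [u v]; rewrite /tadj !inE !xpair_eqE /=.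
case/or4P => [|||/or3P[]] /andP[/eqP h1 /eqP h2].
- exists x, y; left; apply: Or31; congr (_, (_, _)); lia.
- exists x, y; right; apply: Or33; congr ((_, _), _); lia.
- exists u, y; left; apply: Or32; congr ((_, _), (_, _)); lia.
- exists u, v; right; apply: Or31; congr (_, (_, _)); lia.
- exists u, v; left; apply: Or33; congr ((_, _), _); lia.
- exists x, v; right; apply: Or32; congr ((_, _), (_, _)); lia.
Qed.

(** A side-2 upward triangle encloses three upward unit triangles and one downward, a side-2
    downward triangle the opposite; the sides of the former contribute [z ^+ 3] to the holonomy,
    those of the latter its inverse. *)
Lemma coarse_fluxes a b om z : a != 0 -> b != 0 -> z != 0 -> fluxes a b om ->
  fluxes (a ^+ 3 * b / z ^+ 3) (b ^+ 3 * a * z ^+ 3) (coarse om z).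
Proof.
move=> a0 b0 z0 H; split.
- move=> p q /tadj_cases[x [y h]].
  have [[[n1 n2 n3][n4 n5 n6]] [[i1 i2 i3][i4 i5 i6]] _ _ hw] :=
    cell_edges (2 * x) (2 * y) a0 b0 H.
  have [[c1 c2 c3][c4 c5 c6]] := coarse_steps om z x y.
  by case: h => [[] [-> ->]|[] [-> ->]];
    rewrite ?(c1, c2, c3, c4, c5, c6) ?(i1, i2, i3, i4, i5, i6); field; nz.
- move=> x y.
  have [[[n1 n2 n3][n4 n5 n6]] _ _ _ hw] := cell_edges (2 * x) (2 * y) a0 b0 H.
  have [[-> -> ->] _] := coarse_steps om z x y.
  by rewrite invfM invrK -hw; ring.
- move=> x y.
  have [_ [_ -> _]] := coarse_steps om z x y.
  have [_ [_ _ ->]] := coarse_steps om z (x + 1) y.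
  have [_ [-> _ _]] := coarse_steps om z x (y + 1).
  have [-> ->] : 2 * (x + 1) = 2 * x + 1 + 1 /\ 2 * (y + 1) = 2 * y + 1 + 1 by split; lia.
  case: (H) => _ U D.
  (* [D1], [D2], [D3] are the three corners of the side-2 downward triangle and [U1] is its
     centre. *)
  have D1 := D (2 * x + 1) (2 * y); have D2 := D (2 * x + 1) (2 * y + 1).
  have D3 := D (2 * x) (2 * y + 1); have U1 := U (2 * x + 1) (2 * y + 1).
  have [[_ t2 _] [t1 _ t3]] := tadj_steps (2 * x + 1) (2 * y + 1).
  have T1 := fluxes_neq0 H t1; have T2 := fluxes_neq0 H t2; have T3 := fluxes_neq0 H t3.
  move/(fluxes_inv H) in t1; move/(fluxes_inv H) in t2; move/(fluxes_inv H) in t3.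
  rewrite t1 t2 t3 in U1.
  transitivity ((b^-1) ^+ 3 * a^-1 / z ^+ 3); last by field; nz.
  rewrite !exprS expr0 mulr1 -{1}D1 -{1}D2 -D3 -U1.
  field; nz.
Qed.

Lemma nbsum_dbl N (g : int * int -> C) x y : nbsum N.+1 g (2 * x, 2 * y) =
  (cell N x y)%:R * (g (2 * x + 1, 2 * y) + g (2 * x, 2 * y + 1))
  + (cell N (x - 1) y)%:R * (g (2 * (x - 1) + 1, 2 * y) + g (2 * (x - 1) + 1, 2 * y + 1))
  + (cell N x (y - 1))%:R * (g (2 * x, 2 * (y - 1) + 1) + g (2 * x + 1, 2 * (y - 1) + 1)).
Proof.
have K (u : int) : 2 * u - 1 = 2 * (u - 1) + 1 by lia.
have [c1 _ _ _] := cell_double N x y.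
have [_ c2 _ _] := cell_double N (x - 1) y.
have [_ _ c3 _] := cell_double N x (y - 1).
by rewrite /nbsum /= !K c1 c2 c3.
Qed.

Lemma ncell_dbl N p : ncell C N.+1 (dbl p) = ncell C N p.
Proof.
case: p => x y; have K (u : int) : 2 * u - 1 = 2 * (u - 1) + 1 by lia.
have [c1 _ _ _] := cell_double N x y.
have [_ c2 _ _] := cell_double N (x - 1) y.
have [_ _ c3 _] := cell_double N x (y - 1).
by rewrite /ncell /dbl /= !K c1 c2 c3.
Qed.

(** A midpoint has all four neighbours within the one cell of [G_N] whose side it halves; degree 4
    is the origin of [s = 4 (1 - l)]. *)
Lemma nbsum_mid N (g : int * int -> C) x y :
  [/\ nbsum N.+1 g (2 * x + 1, 2 * y) = (cell N x y)%:R *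
       (g (2 * x + 1 + 1, 2 * y) + g (2 * x + 1, 2 * y + 1) + (g (2 * x, 2 * y) + g (2 * x, 2 * y + 1))),
      nbsum N.+1 g (2 * x, 2 * y + 1) = (cell N x y)%:R *
       (g (2 * x + 1, 2 * y + 1) + g (2 * x, 2 * y + 1 + 1) + (g (2 * x, 2 * y) + g (2 * x + 1, 2 * y))) &
      nbsum N.+1 g (2 * x + 1, 2 * y + 1) = (cell N x y)%:R *
       (g (2 * x, 2 * y + 1) + g (2 * x, 2 * y + 1 + 1) + (g (2 * x + 1, 2 * y) + g (2 * x + 1 + 1, 2 * y)))].
Proof.
have K (u : int) : 2 * u - 1 = 2 * (u - 1) + 1 by lia.
have [c1 c2 c3 c4] := cell_double N x y.
have [_ _ _ d1] := cell_double N (x - 1) y.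
have [_ _ _ d2] := cell_double N x (y - 1).
rewrite /nbsum; split; rewrite /= ?addrK ?K ?c1 ?c2 ?c3 ?c4 ?d1 ?d2 !mulr0n; ring.
Qed.

Lemma ncell_mid N x y :
  [/\ ncell C N.+1 (2 * x + 1, 2 * y) = 2 * (cell N x y)%:R,
      ncell C N.+1 (2 * x, 2 * y + 1) = 2 * (cell N x y)%:R &
      ncell C N.+1 (2 * x + 1, 2 * y + 1) = 2 * (cell N x y)%:R].
Proof.
have [h1 h2 h3] := nbsum_mid N (fun=> 1) x y.
have I2 : 2 != 0 :> C by rewrite pnatr_eq0.
by split; apply: (mulfI I2); rewrite -nbsum1 ?(h1, h2, h3); ring.
Qed.

Lemma parity_cases (p : int * int) : exists x y,
  [\/ p = (2 * x, 2 * y), p = (2 * x + 1, 2 * y), p = (2 * x, 2 * y + 1)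
    | p = (2 * x + 1, 2 * y + 1)].
Proof.
case: p => u v; exists (u %/ 2)%Z, (v %/ 2)%Z.
have [hu|hu] : u = 2 * (u %/ 2)%Z \/ u = 2 * (u %/ 2)%Z + 1 by lia.
  have [hv|hv] : v = 2 * (v %/ 2)%Z \/ v = 2 * (v %/ 2)%Z + 1 by lia.
    by apply: Or41; congr pair.
  by apply: Or43; congr pair.
have [hv|hv] : v = 2 * (v %/ 2)%Z \/ v = 2 * (v %/ 2)%Z + 1 by lia.
  by apply: Or42; congr pair.
by apply: Or44; congr pair.
Qed.

(** * Schur complement onto the coarse vertices *)

Section Cell.
Variables (N : nat) (om : int * int -> int * int -> C) (a b s z rho : C).
Hypotheses (a0 : a != 0) (b0 : b != 0) (H : fluxes a b om) (D0 : mid_det s b != 0).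

Definition mid_eigen f x y : Prop :=
  let P0 := (2 * x, 2 * y) in let P1 := (2 * x + 1 + 1, 2 * y) in
  let P2 := (2 * x, 2 * y + 1 + 1) in
  let m1 := (2 * x + 1, 2 * y) in let m2 := (2 * x, 2 * y + 1) in
  let m3 := (2 * x + 1, 2 * y + 1) in
  [/\ s * f m1 = om m1 P0 * f P0 + om m1 P1 * f P1 + om m1 m3 * f m3 + om m1 m2 * f m2,
      s * f m3 = om m3 P1 * f P1 + om m3 P2 * f P2 + om m3 m2 * f m2 + om m3 m1 * f m1 &
      s * f m2 = om m2 P2 * f P2 + om m2 P0 * f P0 + om m2 m1 * f m1 + om m2 m3 * f m3].

(** The triple is ordered counterclockwise as [m1], [m3], [m2], so each entry rotates the arguments
    of the previous one. *)
Definition midfun f (x y : int) : C * C * C :=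
  let P0 := (2 * x, 2 * y) in let P1 := (2 * x + 1 + 1, 2 * y) in
  let P2 := (2 * x, 2 * y + 1 + 1) in
  let m1 := (2 * x + 1, 2 * y) in let m2 := (2 * x, 2 * y + 1) in
  let m3 := (2 * x + 1, 2 * y + 1) in
  let w1 := om P0 m1 in let w2 := om m1 P1 in let w3 := om P1 m3 in
  let w4 := om m3 P2 in let w5 := om P2 m2 in let w6 := om m2 P0 in
  (midval s a b w1 w2 w5 w6 (f P0) (f P1) (f P2),
   midval s a b w3 w4 w1 w2 (f P1) (f P2) (f P0),
   midval s a b w5 w6 w3 w4 (f P2) (f P0) (f P1)).

Lemma mid_eigenE f x y : mid_eigen f x y <->
  (f (2 * x + 1, 2 * y), f (2 * x + 1, 2 * y + 1), f (2 * x, 2 * y + 1)) = midfun f x y.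
Proof.
rewrite /mid_eigen /midfun /=.
have [[[n1 n2 n3][n4 n5 n6]] [[i1 i2 i3][i4 i5 i6]] [-> -> ->] [-> -> ->] hw] :=
  cell_edges (2 * x) (2 * y) a0 b0 H.
rewrite i1 i3 i5 /=.
move: hw n1 n2 n3 n4 n5 n6 {i1 i2 i3 i4 i5 i6}.
set w1 := om _ _; set w2 := om _ (_ + 1 + 1, _); set w3 := om _ (_ + 1, _).
set w4 := om _ (_, _ + 1 + 1); set w5 := om _ (2 * x, 2 * y + 1); set w6 := om _ (2 * x, 2 * y).
move=> hw n1 n2 n3 n4 n5 n6.
have hw2 : w3 * w4 * w5 * w6 * w1 * w2 = (a ^+ 3 * b)^-1 by rewrite -hw; ring.
have hw3 : w5 * w6 * w1 * w2 * w3 * w4 = (a ^+ 3 * b)^-1 by rewrite -hw; ring.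
split=> [[E1 E2 E3]|[-> -> ->]].
  by congr (_, _, _); [apply: (mideq_val _ _ _ _ _ _ _ _ hw) E1 E2 E3
    | apply: (mideq_val _ _ _ _ _ _ _ _ hw2) E2 E3 E1 | apply: (mideq_val _ _ _ _ _ _ _ _ hw3) E3 E1 E2].
by split; [apply: (val_mideq _ _ _ _ _ _ _ _ _ _ _ hw) | apply: (val_mideq _ _ _ _ _ _ _ _ _ _ _ hw2)
 | apply: (val_mideq _ _ _ _ _ _ _ _ _ _ _ hw3)].
Qed.

(** The diagonal term produced by the elimination; it will be [2 * Af]. *)
Definition corner_coef := 2 * (s ^+ 2 - 1) + s * (a + a^-1) + a * b + (a * b)^-1.

(** [rho] and [z] stand for modulus and phase of [16 Psi]. As [rho] may vanish, the case [Psi = 0]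
    is covered as well. *)
Hypotheses (z0 : z != 0) (Hpsi : psi_poly s a b = rho * z) (Hpsi' : psi_poly s a^-1 b^-1 = rho / z).

Lemma corner_renorm f x y : mid_eigen f x y ->
  let P0 := (2 * x, 2 * y) in let P1 := (2 * x + 1 + 1, 2 * y) in
  let P2 := (2 * x, 2 * y + 1 + 1) in
  let m1 := (2 * x + 1, 2 * y) in let m2 := (2 * x, 2 * y + 1) in
  let m3 := (2 * x + 1, 2 * y + 1) in
  [/\ mid_det s b * (om P0 m1 * f m1 + om P0 m2 * f m2) = corner_coef * f P0 + rho *
        (coarse om z (x, y) (x + 1, y) * f P1 + coarse om z (x, y) (x, y + 1) * f P2),
      mid_det s b * (om P1 m1 * f m1 + om P1 m3 * f m3) = corner_coef * f P1 + rho *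
        (coarse om z (x + 1, y) (x, y) * f P0 + coarse om z (x + 1, y) (x, y + 1) * f P2) &
      mid_det s b * (om P2 m2 * f m2 + om P2 m3 * f m3) = corner_coef * f P2 + rho *
        (coarse om z (x, y + 1) (x, y) * f P0 + coarse om z (x, y + 1) (x + 1, y) * f P1)].
Proof.
move=> /mid_eigenE.
have [[-> -> ->] [-> -> ->]] := coarse_steps om z x y.
rewrite /midfun /=.
have [[[n1 n2 n3][n4 n5 n6]] [[-> -> _][-> _ ->]] _ _ hw] :=
  cell_edges (2 * x) (2 * y) a0 b0 H.
have [_ [[_ _ ->][_ -> _]] _ _ _] := cell_edges (2 * x) (2 * y) a0 b0 H.
move: hw n1 n2 n3 n4 n5 n6.
set w1 := om _ (2 * x + 1, 2 * y); set w2 := om _ (_ + 1 + 1, _); set w3 := om _ (_ + 1, _ + 1).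
set w4 := om _ (_, _ + 1 + 1); set w5 := om _ (2 * x, 2 * y + 1); set w6 := om _ (2 * x, 2 * y).
move=> hw n1 n2 n3 n4 n5 n6 [-> -> ->].
have hw2 : w3 * w4 * w5 * w6 * w1 * w2 = (a ^+ 3 * b)^-1 by rewrite -hw; ring.
have hw3 : w5 * w6 * w1 * w2 * w3 * w4 = (a ^+ 3 * b)^-1 by rewrite -hw; ring.
split.
- by rewrite (corner_sum _ _ _ a0 b0 n1 n2 n3 n4 n5 n6 hw D0) Hpsi Hpsi' /corner_coef; field; nz.
- rewrite [X in mid_det s b * X]addrC.
  by rewrite (corner_sum _ _ _ a0 b0 n3 n4 n5 n6 n1 n2 hw2 D0) Hpsi Hpsi' /corner_coef; field; nz.
- by rewrite (corner_sum _ _ _ a0 b0 n5 n6 n1 n2 n3 n4 hw3 D0) Hpsi Hpsi' /corner_coef; field; nz.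
Qed.

Lemma nbsum_renorm f x y : (forall x y, cell N x y -> mid_eigen f x y) ->
  mid_det s b * nbsum N.+1 (fun q => om (2 * x, 2 * y) q * f q) (2 * x, 2 * y) =
  corner_coef * ncell C N (x, y) * f (2 * x, 2 * y)
  + rho * nbsum N (fun q => coarse om z (x, y) q * f (dbl q)) (x, y).
Proof.
move=> hm; rewrite nbsum_dbl /nbsum /ncell /dbl /=.
have K (u : int) : [/\ 2 * (u - 1) + 1 + 1 = 2 * u, u - 1 + 1 = u & 2 * (u + 1) = 2 * u + 1 + 1].
  by split; lia.
have [Kx Kx' Kx2] := K x; have [Ky Ky' Ky2] := K y.
(* The vertex is the corner P0, P1 or P2 of the cell in [e0], [e1], [e2] respectively. *)
have e0 : (cell N x y)%:R * (mid_det s b * (om (2 * x, 2 * y) (2 * x + 1, 2 * y) * f (2 * x + 1, 2 * y)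
   + om (2 * x, 2 * y) (2 * x, 2 * y + 1) * f (2 * x, 2 * y + 1))) =
  (cell N x y)%:R * (corner_coef * f (2 * x, 2 * y) + rho *
        (coarse om z (x, y) (x + 1, y) * f (2 * (x + 1), 2 * y) + coarse om z (x, y) (x, y + 1) * f (2 * x, 2 * (y + 1)))).
  case E: (cell N x y); last by rewrite !mul0r.
  by have [-> _ _] := corner_renorm (hm _ _ E); rewrite Kx2 Ky2.
have e1 : (cell N (x - 1) y)%:R * (mid_det s b * (om (2 * x, 2 * y) (2 * (x - 1) + 1, 2 * y) * f (2 * (x - 1) + 1, 2 * y)
   + om (2 * x, 2 * y) (2 * (x - 1) + 1, 2 * y + 1) * f (2 * (x - 1) + 1, 2 * y + 1))) =
  (cell N (x - 1) y)%:R * (corner_coef * f (2 * x, 2 * y) + rho *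
        (coarse om z (x, y) (x - 1, y) * f (2 * (x - 1), 2 * y) + coarse om z (x, y) (x - 1, y + 1) * f (2 * (x - 1), 2 * (y + 1)))).
  case E: (cell N (x - 1) y); last by rewrite !mul0r.
  by have := corner_renorm (hm _ _ E); rewrite /= Kx Kx' => -[_ -> _]; rewrite Ky2.
have e2 : (cell N x (y - 1))%:R * (mid_det s b * (om (2 * x, 2 * y) (2 * x, 2 * (y - 1) + 1) * f (2 * x, 2 * (y - 1) + 1)
   + om (2 * x, 2 * y) (2 * x + 1, 2 * (y - 1) + 1) * f (2 * x + 1, 2 * (y - 1) + 1))) =
  (cell N x (y - 1))%:R * (corner_coef * f (2 * x, 2 * y) + rho *
        (coarse om z (x, y) (x, y - 1) * f (2 * x, 2 * (y - 1)) + coarse om z (x, y) (x + 1, y - 1) * f (2 * (x + 1), 2 * (y - 1)))).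
  case E: (cell N x (y - 1)); last by rewrite !mul0r.
  by have := corner_renorm (hm _ _ E); rewrite /= Ky Ky' => -[_ _ ->]; rewrite Kx2.
rewrite [LHS]mulrDr [X in X + _]mulrDr !(mulrCA (mid_det s b)) e0 e1 e2; ring.
Qed.

(** At midpoints the eigenvalue equation is [mid_eigen]. At doubled points, multiplied by the
    nonzero [mid_det], it is the coarse equation, with [2 (1 - l) = s / 2]. *)
Lemma eigfun_renorm l f : s = 4 * (1 - l) -> eigfun N.+1 om l f <->
  (forall x y, cell N x y -> mid_eigen f x y) /\
  (forall p, ncell C N p * (s / 2 * mid_det s b - corner_coef) * f (dbl p) =
     rho * nbsum N (fun q => coarse om z p q * f (dbl q)) p).
Proof.
move=> sl; have E x y : cell N x y -> mid_eigen f x y <->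
   [/\ 2 * ncell C N.+1 (2 * x + 1, 2 * y) * (1 - l) * f (2 * x + 1, 2 * y) =
       nbsum N.+1 (fun q => om (2 * x + 1, 2 * y) q * f q) (2 * x + 1, 2 * y),
       2 * ncell C N.+1 (2 * x + 1, 2 * y + 1) * (1 - l) * f (2 * x + 1, 2 * y + 1) =
       nbsum N.+1 (fun q => om (2 * x + 1, 2 * y + 1) q * f q) (2 * x + 1, 2 * y + 1) &
       2 * ncell C N.+1 (2 * x, 2 * y + 1) * (1 - l) * f (2 * x, 2 * y + 1) =
       nbsum N.+1 (fun q => om (2 * x, 2 * y + 1) q * f q) (2 * x, 2 * y + 1)].
  move=> hc.
  have [h1 _ _] := nbsum_mid N (fun q => om (2 * x + 1, 2 * y) q * f q) x y.
  have [_ h2 _] := nbsum_mid N (fun q => om (2 * x, 2 * y + 1) q * f q) x y.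
  have [_ _ h3] := nbsum_mid N (fun q => om (2 * x + 1, 2 * y + 1) q * f q) x y.
  have [k1 k2 k3] := ncell_mid N x y.
  rewrite h1 h2 h3 k1 k2 k3 hc /mid_eigen sl !mul1r !mulr1.
  by split=> [[E1 E2 E3]|[E1 E2 E3]]; split;
    [move: E1|move: E2|move: E3|move: E1|move: E2|move: E3] => e;
    (etransitivity; [etransitivity; [|exact: e]|]); ring.
split=> [h|[h1 h2] p].
  have hm x y : cell N x y -> mid_eigen f x y.
    by move=> /E ->; split; apply: h.
  split=> // -[x y]; have := nbsum_renorm x y hm.
  rewrite -(h (2 * x, 2 * y)) -/(dbl (x, y)) ncell_dbl => e.
  apply: (addrI (corner_coef * ncell C N (x, y) * f (dbl (x, y)))).
  by rewrite -e sl; field.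
have [x [y [] ->]] := parity_cases p.
- apply: (mulfI D0); rewrite (nbsum_renorm x y h1) -(h2 (x, y)) -/(dbl (x, y)) ncell_dbl.
  by rewrite sl; field.
(* A point with an odd coordinate is a midpoint of the cell at [(x, y)], or else its equation is
   void. *)
all: case hc: (cell N x y); first by have [] := (E _ _ hc).1 (h1 _ _ hc).
all: have [k1 k2 k3] := ncell_mid N x y.
all: rewrite ?k1 ?k2 ?k3 hc !mulr0n !(mulr0, mul0r).
- by case: (nbsum_mid N (fun q => om (2 * x + 1, 2 * y) q * f q) x y) => -> _ _; rewrite hc mulr0n mul0r.
- by case: (nbsum_mid N (fun q => om (2 * x, 2 * y + 1) q * f q) x y) => _ -> _; rewrite hc mulr0n mul0r.
- by case: (nbsum_mid N (fun q => om (2 * x + 1, 2 * y + 1) q * f q) x y) => _ _ ->; rewrite hc mulr0n mul0r.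
Qed.

End Cell.
End Renorm.

(** Serves to compare eigenspaces: [phi] will restrict functions on [V_(N+1)] to the doubled
    vertices. *)
Lemma rank_eq_inj_surj (F : fieldType) (m n : nat) (A : 'M[F]_m) (B : 'M[F]_n) (phi : 'M[F]_(m, n)) :
  (forall u : 'rV_m, (u <= A)%MS -> (u *m phi <= B)%MS) ->
  (forall u : 'rV_m, (u <= A)%MS -> u *m phi = 0 -> u = 0) ->
  (forall w : 'rV_n, (w <= B)%MS -> exists2 u : 'rV_m, (u <= A)%MS & u *m phi = w) ->
  \rank A = \rank B.
Proof.
move=> h1 h2 h3.
have -> : \rank B = \rank (A *m phi).
  apply/eqP; rewrite eqn_leq !mxrankS //.
    by apply/row_subP => i; rewrite row_mul h1 // row_sub.
  by apply/row_subP => i; have [u /submxMr uA <-] := h3 _ (row_sub i B); exact: uA.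
apply/esym/mxrank_injP; rewrite -submx0; apply/row_subP => i.
set u := row i _; have : (u <= A :&: kermx phi)%MS by exact: row_sub.
by rewrite sub_capmx => /andP[uA /sub_kermxP /(h2 _ uA) ->]; rewrite sub0mx.
Qed.

(** * Uniqueness of the connection up to gauge *)

Section Gauge.
Variable R : realType.
Local Notation C := R[i].
Implicit Types (om : int * int -> int * int -> C) (f : int * int -> C) (p q : int * int).
Local Ltac nz := repeat (apply/andP; split); by rewrite ?mulf_neq0 ?expf_neq0 ?oppr_eq0 ?oner_neq0 ?invr_eq0.

(* Transport along the row [b = 0] and then along columns; triviality of all
   triangle holonomies of [om / om'] makes this path independent. *)
Fixpoint gauge_row (r : int * int -> int * int -> C) (m : nat) : C :=
  if m is k.+1 then gauge_row r k * r (k%:Z, 0) (k%:Z + 1, 0) else 1.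
Fixpoint gauge_col (r : int * int -> int * int -> C) (m n : nat) : C :=
  if n is k.+1 then gauge_col r m k * r (m%:Z, k%:Z) (m%:Z, k%:Z + 1) else gauge_row r m.

(** The edges of [G_N] stay in the nonnegative quadrant; elsewhere any nonzero value will do. *)
Definition gauge r p : C :=
  match p with (Posz m, Posz n) => gauge_col r m n | _ => 1 end.

Arguments gauge : simpl never.

Lemma eq_nbsum N (g h : int * int -> C) p :
  (forall q, edge N p q -> g q = h q) -> nbsum N g p = nbsum N h p.
Proof.
move=> H; rewrite /nbsum; case: (edge_steps N p) => [[h1 h2] [h3 h4] [h5 h6]].
congr (_ + _ + _).
- by case E: (cell _ _ _); rewrite ?mul0r // !H ?(h1 E) ?(h2 E).
- by case E: (cell _ _ _); rewrite ?mul0r // !H ?(h3 E) ?(h4 E).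
- by case E: (cell _ _ _); rewrite ?mul0r // !H ?(h5 E) ?(h6 E).
Qed.

(** The ratio [r] of the two connections has trivial holonomy around all unit triangles, hence is a
    gradient, and its potential is the gauge. *)
Lemma fluxes_gauge a b om om' : a != 0 -> b != 0 -> fluxes a b om -> fluxes a b om' ->
  exists2 g : int * int -> C, (forall p, g p != 0) &
    forall N p f, nbsum N (fun q => om' p q * (g q * f q)) p = g p * nbsum N (fun q => om p q * f q) p.
Proof.
move=> a0 b0 H H'; pose r p q := om p q / om' p q.
have r0 p q : tadj p q -> r p q != 0.
  by move=> h; rewrite /r mulf_neq0 ?invr_eq0 ?(fluxes_neq0 H h) ?(fluxes_neq0 H' h).
have rV p q : tadj p q -> r q p = (r p q)^-1.
  by move=> h; rewrite /r (fluxes_inv H h) (fluxes_inv H' h) invfM.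
have rU x y : r (x, y) (x + 1, y) * r (x + 1, y) (x, y + 1) * r (x, y + 1) (x, y) = 1.
  case: (H) (H') => _ U _ [_ U' _]; rewrite /r.
  have [[t1 t2 t3] [t4 t5 t6]] := tadj_steps x y.
  transitivity (a^-1 / a^-1); last by field; nz.
  rewrite -{1}(U x y) -(U' x y); field.
  by rewrite (fluxes_neq0 H' t1) (fluxes_neq0 H' t3) (fluxes_neq0 H' t5).
have rD x y : r (x + 1, y) (x + 1, y + 1) * r (x + 1, y + 1) (x, y + 1) * r (x, y + 1) (x + 1, y) = 1.
  case: (H) (H') => _ _ U [_ _ U']; rewrite /r.
  have [[t1 t2 t3] [t4 t5 t6]] := tadj_steps x y.
  have [[_ u2 _] _] := tadj_steps (x + 1) y.
  have [_ [v4 _ _]] := tadj_steps x (y + 1).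
  transitivity (b^-1 / b^-1); last by field; nz.
  rewrite -{1}(U x y) -(U' x y); field.
  by rewrite (fluxes_neq0 H' u2) (fluxes_neq0 H' v4) (fluxes_neq0 H' t6).
have row0 m : gauge_row r m != 0.
  elim: m => [|m IH] /=; first exact: oner_neq0.
  by rewrite mulf_neq0// r0//; have [[]] := tadj_steps m 0.
have col0 m n : gauge_col r m n != 0.
  elim: n => [|n IH] //=.
  by rewrite mulf_neq0// r0//; have [[]] := tadj_steps m n.
(* Horizontal steps at height [n] follow by induction, crossing one unit square, that is, one upward
   and one downward triangle. *)
have hor (m n : nat) : gauge_col r m.+1 n = gauge_col r m n * r (m%:Z, n%:Z) (m%:Z + 1, n%:Z).
  elim: n => [//|n IH] /=; rewrite IH.
  have [[t1 t2 t3] [t4 t5 t6]] := tadj_steps m n.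
  have [[_ u2 _] _] := tadj_steps (m%:Z + 1) n.
  have [_ [v4 _ _]] := tadj_steps m (n%:Z + 1).
  have -> : m.+1%:Z = m%:Z + 1 by lia.
  have -> : n.+1%:Z = n%:Z + 1 by lia.
  have := rD m n; have := rU m n.
  rewrite (rV _ _ v4) (rV _ _ t2) (rV _ _ t3).
  move: (r0 _ _ t2) (r0 _ _ t3) (r0 _ _ u2) (r0 _ _ v4).
  set A := r (m%:Z, n%:Z) _; set D := r (_, _ + 1) _; set V := r (m%:Z, n%:Z) _.
  set V' := r (m%:Z + 1, n%:Z) _; set B := r (m%:Z + 1, _) _.
  move=> A0 V0 B0 D0 e1 e2.
  have -> : A = V * V' by rewrite -[A]mul1r -e1 divfK.
  have -> : V' = B * D by rewrite -[V']mul1r -e2 divfK.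
  by field.
have three (m n : nat) :
    [/\ gauge r (m%:Z + 1, n%:Z) = gauge r (m%:Z, n%:Z) * r (m%:Z, n%:Z) (m%:Z + 1, n%:Z),
        gauge r (m%:Z, n%:Z + 1) = gauge r (m%:Z, n%:Z) * r (m%:Z, n%:Z) (m%:Z, n%:Z + 1) &
        gauge r (m%:Z, n%:Z + 1) = gauge r (m%:Z + 1, n%:Z) * r (m%:Z + 1, n%:Z) (m%:Z, n%:Z + 1)].
  have E1 : gauge r (m%:Z + 1, n%:Z) = gauge r (m%:Z, n%:Z) * r (m%:Z, n%:Z) (m%:Z + 1, n%:Z).
    have e : m%:Z + 1 = m.+1%:Z by lia.
    by rewrite [in LHS]e /gauge hor.
  have E2 : gauge r (m%:Z, n%:Z + 1) = gauge r (m%:Z, n%:Z) * r (m%:Z, n%:Z) (m%:Z, n%:Z + 1).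
    have e : n%:Z + 1 = n.+1%:Z by lia.
    by rewrite [in LHS]e.
  split=> //; rewrite E1 E2 -mulrA; congr (_ * _).
  have [[_ t2 _] _] := tadj_steps m n.
  have := rU m n; rewrite (rV _ _ t2) => e.
  by rewrite -[LHS]mul1r -e divfK ?r0.
have gr N p q : edge N p q -> gauge r q = gauge r p * r p q.
  have nonneg x y : cell N x y -> exists m n : nat, x = m%:Z /\ y = n%:Z.
    by move/cell_bound => /and3P[hx hy _]; exists `|x|%N, `|y|%N; rewrite !gez0_abs.
  case: p => x y; rewrite /edge /= => /or3P[] /andP[hq /nonneg [m [n [hm hn]]]].
  - have [h1 h2 _] := three m n.
    by case/orP: hq => /eqP ->; rewrite hm hn.
  - have {hm}hm : x = m%:Z + 1 by rewrite -hm subrK.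
    have [h1 h2 h3] := three m n; have [[t1 t2 t3] _] := tadj_steps m n.
    case/orP: hq => /eqP ->; rewrite hm hn addrK; last exact: h3.
    by rewrite h1 (rV _ _ t1) mulfK // r0.
  - have {hn}hn : y = n%:Z + 1 by rewrite -hn subrK.
    have [h1 h2 h3] := three m n; have [[t1 t2 t3] _] := tadj_steps m n.
    case/orP: hq => /eqP ->; rewrite hm hn addrK.
      by rewrite h2 (rV _ _ t2) mulfK // r0.
    by rewrite h3 (rV _ _ t3) mulfK // r0.
exists (gauge r); first by case=> [[m|m] [n|n]]; rewrite /gauge ?oner_neq0.
move=> N p f; transitivity (nbsum N (fun q => gauge r p * (om p q * f q)) p); last first.
  by rewrite /nbsum; ring.
apply: eq_nbsum => q h; rewrite (gr _ _ _ h) /r.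
by field; rewrite (fluxes_neq0 H' (edge_tadj h)).
Qed.
End Gauge.

(** * Counting vertices *)

Section Count.
Local Open Scope nat_scope.

Lemma sum_double (F : nat -> nat) n :
  \sum_(i < n.*2) F i = \sum_(i < n) (F i.*2 + F i.*2.+1).
Proof.
elim: n => [|n IH]; first by rewrite !big_ord0.
by rewrite doubleS !big_ord_recr /= IH addnA.
Qed.

Definition boxsum n (F : nat -> nat -> nat) := \sum_(i < n) \sum_(j < n) F i j.

Lemma boxsum_double n F : boxsum n.*2 F = boxsum n (fun i j =>
  F i.*2 j.*2 + F i.*2 j.*2.+1 + (F i.*2.+1 j.*2 + F i.*2.+1 j.*2.+1)).
Proof.
rewrite /boxsum (sum_double (fun i => \sum_(j < n.*2) F i j)).
by apply: eq_bigr => i _; rewrite !sum_double -big_split.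
Qed.

Lemma int_double (u : nat) : [/\ (u.*2%:Z = 2 * u)%R, (u.*2.+1%:Z = 2 * u + 1)%R,
  (2 * u%:Z - 1 = 2 * (u%:Z - 1) + 1)%R & (2 * u%:Z + 1 - 1 = 2 * u%:Z)%R].
Proof. by split; lia. Qed.

Lemma cell_card N : boxsum (2 ^ N.+1) (fun i j => cell N i j) = 3 ^ N.
Proof.
elim: N => [|N IH]; first by rewrite /boxsum !big_ord_recr !big_ord0.
rewrite expnS mul2n boxsum_double (expnS 3) -IH /boxsum big_distrr /=.
apply: eq_bigr => i _; rewrite big_distrr /=; apply: eq_bigr => j _.
have [h1 h2 h3 h4] := cell_double N i j.
have [-> -> _ _] := int_double i; have [-> -> _ _] := int_double j.
by rewrite h1 h2 h3 h4; case: (cell _ _ _).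
Qed.

(** Subdivision keeps the old vertices and adds three midpoints per cell, and there are [3 ^ N]
    cells. The box has side [2 ^ N.+1], a power of two, so that it halves exactly. *)
Lemma inV_card_box N : boxsum (2 ^ N.+1) (fun i j => inV N (i, j)) = (3 ^ N.+1 + 3) %/ 2.
Proof.
elim: N => [|N IH]; first by rewrite /boxsum !big_ord_recr !big_ord0.
have E i j : inV N.+1 (i.*2, j.*2) + inV N.+1 (i.*2, j.*2.+1) +
   (inV N.+1 (i.*2.+1, j.*2) + inV N.+1 (i.*2.+1, j.*2.+1)) = inV N (i, j) + 3 * cell N i j.
  have [h1 h2 h3 h4] := cell_double N i j.
  have [h5 h6 h7 h8] := cell_double N (i%:Z - 1) j.
  have [k5 k6 k7 k8] := cell_double N i (j%:Z - 1).
  have [Ei Ei' Ki Ai] := int_double i; have [Ej Ej' Kj Aj] := int_double j.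
  rewrite !inVE !Ei !Ei' !Ej !Ej' !Ai !Aj !Ki !Kj h1 h2 h3 h4 h6 h8 k7 k8.
  by do 3![case: (cell _ _ _)].
rewrite expnS mul2n boxsum_double.
rewrite /boxsum; under eq_bigr => i _ do under eq_bigr => j _ do rewrite E.
under eq_bigr => i _ do rewrite big_split -big_distrr.
rewrite big_split /= -big_distrr /=.
move: IH (cell_card N); rewrite /boxsum => -> ->.
by rewrite (expnS 3 N.+1) (expnS 3 N); lia.
Qed.

Lemma sum_widen n m (F : nat -> nat) : n <= m -> (forall i, n <= i -> F i = 0) ->
  \sum_(i < n) F i = \sum_(i < m) F i.
Proof.
move=> nm h; rewrite (big_ord_widen _ F nm) big_mkcond /=; apply: eq_bigr => i _.
by case: ltnP => // /h ->.
Qed.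

Lemma card_VT N : #|{: VT N}| = (3 ^ N.+1 + 3) %/ 2.
Proof.
rewrite -inV_card_box card_sig -sum1_card.
rewrite (eq_bigl (fun p : 'I_(2 ^ N).+1 * 'I_(2 ^ N).+1 => inV N (nat_of_ord p.1, nat_of_ord p.2))) //.
rewrite big_mkcond /= -(pair_bigA _ (fun i j : 'I_(2 ^ N).+1 =>
  if inV N (nat_of_ord i, nat_of_ord j) then 1 else 0)) /=.
(* The index box of [VT] is enlarged to this power of two; the added points are not vertices. *)
have le : (2 ^ N).+1 <= 2 ^ N.+1 by rewrite expnS; have := expn_gt0 2 N; lia.
have out i j : (2 ^ N < i) || (2 ^ N < j) -> inV N (i, j) = false.
  by rewrite inVE => h; apply/negP => /or3P[] /cell_bound; lia.
rewrite /boxsum -(sum_widen (F := fun i => \sum_(j < 2 ^ N.+1) inV N (i, nat_of_ord j)) le); last first.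
  by move=> i hi; rewrite big1// => j _; rewrite out ?hi.
apply: eq_bigr => i _.
rewrite -(sum_widen (F := fun j => inV N (nat_of_ord i, j)) le); last first.
  by move=> j hj; rewrite out ?hj ?orbT.
by apply: eq_bigr => j _; case: (inV _ _).
Qed.

End Count.

(** * Comparison of the eigenspaces *)

Section Mult.
Variable R : realType.
Local Notation C := R[i].
Implicit Types (om : int * int -> int * int -> C) (f : int * int -> C) (p q : int * int).

Lemma vlat_cell N x y : cell N x y -> [/\ exists v : VT N, vlat v = (x, y),
  exists v : VT N, vlat v = (x + 1, y) & exists v : VT N, vlat v = (x, y + 1)].
Proof.
move=> hc.
have K q : edge N (x, y) q -> exists v : VT N, vlat v = q.
  by move=> /edge_inV[a [b [-> h1 h2]]]; apply: vlat_surj.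
have K' q : edge N q (x, y) -> exists v : VT N, vlat v = (x, y).
  by move=> /edge_inV[a [b [-> h1 h2]]]; apply: vlat_surj.
have [[h1 h2] _ _] := edge_steps N (x, y).
split; [| exact: K (h1 hc) | exact: K (h2 hc)].
by apply: (K' (x + 1, y)); rewrite edge_sym; exact: h1 hc.
Qed.

Lemma cell_vlat N (v : VT N) : exists x y, cell N x y /\
  [\/ vlat v = (x, y), vlat v = (x + 1, y) | vlat v = (x, y + 1)].
Proof.
have [a [b [-> ]]] := vlat_inV v; rewrite inVE => /or3P[] h.
- by exists a, b; split=> //; apply: Or31.
- by exists (a%:Z - 1), b%:Z; split=> //; apply: Or32; rewrite subrK.
- by exists a%:Z, (b%:Z - 1); split=> //; apply: Or33; rewrite subrK.
Qed.

Lemma vlat_dbl N (v : VT N) : exists v' : VT N.+1, vlat v' = dbl (vlat v).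
Proof.
have K (u : int) : 2 * (u + 1) = 2 * u + 1 + 1 by lia.
have [x [y [hc h]]] := cell_vlat v.
have [c1 c2 c3 _] := cell_double N x y.
case: h => ->; rewrite /dbl /= ?K.
- by have [? _ _] := vlat_cell (etrans c1 hc).
- by have [_ ? _] := vlat_cell (etrans c2 hc).
- by have [_ _ ?] := vlat_cell (etrans c3 hc).
Qed.

(** Restriction to doubled vertices, twisted by the gauge [g], is injective on the eigenspace
    because corners determine midpoints, and onto because [midfun] extends any coarse solution. [B]
    is left abstract: an eigenspace of the coarse operator when [Psi <> 0], the full space in the
    exceptional case. *)
Lemma mult_renorm N om (a b s z rho l : C) (g : int * int -> C) (B : 'M[C]_#|{: VT N}|) :
  a != 0 -> b != 0 -> fluxes a b om -> mid_det s b != 0 -> z != 0 ->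
  psi_poly s a b = rho * z -> psi_poly s a^-1 b^-1 = rho / z -> s = 4 * (1 - l) ->
  (forall p, g p != 0) ->
  (forall h, (rowf N (fun p => (g p * h p)%R) <= B)%MS <->
     forall p, ncell C N p * (s / 2 * mid_det s b - corner_coef a b s) * h p =
               rho * nbsum N (fun q => coarse om z p q * h q) p) ->
  mult N.+1 om l = \rank B.
Proof.
move=> a0 b0 H D0 z0 P1 P2 sl g0 HB.
pose phi : 'M[C]_(#|{: VT N.+1}|, #|{: VT N}|) := \matrix_(i, j)
  ((vlat (enum_val i) == dbl (vlat (enum_val j)))%:R * g (vlat (enum_val j))).
have phiE u : u *m phi = rowf N (fun p => g p * funof u (dbl p)).
  apply/rowP => j; rewrite !mxE /funof mulr_sumr; apply: eq_bigr => i _.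
  by rewrite !mxE; ring.
have E := eigfun_renorm N a0 b0 H D0 z0 P1 P2 _ sl.
apply: (rank_eq_inj_surj (phi := phi)).
- move=> u; rewrite -{1}(rowfK u) => /eigenspace_rowf /E [_ h2].
  by rewrite phiE; apply/HB.
- move=> u; rewrite -{1}(rowfK u) => /eigenspace_rowf /E [h1 _].
  rewrite phiE => u0.
  have even0 (v : VT N) : funof u (dbl (vlat v)) = 0.
    apply: (mulfI (g0 (vlat v))); rewrite mulr0.
    have := congr1 (fun w : 'rV_ _ => w 0 (enum_rank v)) u0.
    by rewrite !mxE enum_rankK.
  rewrite -(rowfK u); apply/rowP => i; rewrite !mxE.
  move: (enum_val i) => v {i}; have K (t : int) : 2 * (t + 1) = 2 * t + 1 + 1 by lia.
  have Z x y : cell N x y -> [/\ funof u (2 * x, 2 * y) = 0,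
     funof u (2 * x + 1 + 1, 2 * y) = 0 & funof u (2 * x, 2 * y + 1 + 1) = 0].
    move=> /vlat_cell [[v1 e1] [v2 e2] [v3 e3]].
    by have := even0 v1; have := even0 v2; have := even0 v3; rewrite e1 e2 e3 /dbl /= !K.
  have M x y : cell N x y -> [/\ funof u (2 * x + 1, 2 * y) = 0,
     funof u (2 * x + 1, 2 * y + 1) = 0 & funof u (2 * x, 2 * y + 1) = 0].
    move=> hc; have [z1 z2 z3] := Z _ _ hc.
    have /(mid_eigenE a0 b0 H D0) := h1 _ _ hc.
    rewrite /midfun /= z1 z2 z3 /midval !(mulr0, addr0, mul0r).
    by case=> -> -> ->.
  have [x [y [hc h]]] := cell_vlat v.
  (* The parity of a small cell tells which corner of its parent it occupies. *)
  have [x' [y' hp]] := parity_cases (x, y).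
  have [c1 c2 c3 c4] := cell_double N x' y'.
  move: hc; case: hp => -[ex ey]; rewrite ex ey ?(c1, c2, c3, c4) // => hc.
  + have [z1 z2 z3] := Z _ _ hc; have [m1 m2 m3] := M _ _ hc.
    by case: h => ->; rewrite ex ey.
  + have [z1 z2 z3] := Z _ _ hc; have [m1 m2 m3] := M _ _ hc.
    by case: h => ->; rewrite ex ey.
  + have [z1 z2 z3] := Z _ _ hc; have [m1 m2 m3] := M _ _ hc.
    by case: h => ->; rewrite ex ey.
- move=> w wB.
  pose h p := (g p)^-1 * funof w p.
  have gh : rowf N (fun p => g p * h p) = w.
    rewrite -[RHS]rowfK; apply/rowf_eq => v; by rewrite /h mulrA mulfV ?mul1r.
  (* Floor halving sends the doubled base corner and the three midpoints of a cell to its base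
     point. *)
  pose hlf p := ((p.1 %/ 2)%Z, (p.2 %/ 2)%Z).
  pose F0 p := h (hlf p).
  pose f p := let x := (hlf p).1 in let y := (hlf p).2 in
    let: (m1, m3, m2) := midfun om a b s F0 x y in
    if (p.1 %% 2 == 0)%Z then (if (p.2 %% 2 == 0)%Z then F0 p else m2)
    else (if (p.2 %% 2 == 0)%Z then m1 else m3).
  have hl2 (t : int) : [/\ (2 * t %/ 2)%Z = t, ((2 * t + 1) %/ 2)%Z = t,
     (2 * t %% 2)%Z == 0 = true & ((2 * t + 1) %% 2)%Z == 0 = false].
    by split; lia.
  have fd p : f (dbl p) = h p.
    have [e1 e2 e3 e4] := hl2 p.1; have [e1' e2' e3' e4'] := hl2 p.2.
    by rewrite /f /= e3 e3' /F0 /hlf /= e1 e1' -surjective_pairing.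
  have fmid x y : (f (2 * x + 1, 2 * y), f (2 * x + 1, 2 * y + 1), f (2 * x, 2 * y + 1)) =
      midfun om a b s F0 x y.
    have [e1 e2 e3 e4] := hl2 x; have [e1' e2' e3' e4'] := hl2 y.
    by rewrite /f /hlf /= !(e1, e2, e3, e4, e1', e2', e3', e4').
  have K (t : int) : 2 * t + 1 + 1 = 2 * (t + 1) by lia.
  have f0 x y : F0 (2 * x, 2 * y) = f (2 * x, 2 * y).
    have [e1 _ _ _] := hl2 x; have [e1' _ _ _] := hl2 y.
    by rewrite -/(dbl (x, y)) fd /F0 /hlf /= e1 e1'.
  exists (rowf N.+1 f).
    apply/eigenspace_rowf/E; split.
      move=> x y _; apply/(mid_eigenE a0 b0 H D0); rewrite fmid.
      by rewrite /midfun /= !K !f0.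
    move=> p; rewrite fd.
    have -> : (fun q => coarse om z p q * f (dbl q)) = (fun q => coarse om z p q * h q).
      by apply: funext => q; rewrite fd.
    by move: p; apply/HB; rewrite gh.
  rewrite phiE -gh; apply/rowf_eq => v; congr (_ * _).
  have [v' hv] := vlat_dbl v.
  by rewrite -hv -(enum_rankK v') funof_vlat mxE enum_rankK hv fd.
Qed.
End Mult.

(** * Phases *)

Section Expi.
Variable R : realType.
Local Notation C := R[i].
Implicit Types t x : R.

Lemma expiD t x : expi (t + x) = expi t * expi x :> C.
Proof. by apply/eqP; rewrite eq_complex /= cosD sinD addrC eqxx /= addrC (mulrC (sin t)). Qed.

Lemma expi0 : expi 0 = 1 :> C.
Proof. by rewrite /expi cos0 sin0. Qed.

Lemma expi_neq0 t : expi t != 0 :> C.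
Proof.
apply/negP => /eqP h; have := expiD t (- t).
by rewrite subrr expi0 h mul0r => /eqP; rewrite oner_eq0.
Qed.

Lemma expiN t : expi (- t) = (expi t)^-1 :> C.
Proof. by apply: (mulfI (expi_neq0 t)); rewrite -expiD subrr expi0 mulfV ?expi_neq0. Qed.

Lemma conj_expi t : ((expi t)^*)%R = (expi t)^-1 :> C.
Proof. by rewrite -expiN /expi cosN sinN. Qed.

Lemma norm_expi t : `|expi t : C| = 1.
Proof. by rewrite normc_def /= cos2Dsin2 sqrtr1. Qed.

Lemma cos_expi t : (cos t)%:C = (expi t + (expi t)^-1) / 2 :> C.
Proof.
rewrite -expiN; have -> : expi t + expi (- t) = 2 * (cos t)%:C :> C.
  by apply/eqP; rewrite eq_complex /= cosN sinN; apply/andP; split; apply/eqP; ring.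
by field.
Qed.

Lemma expi2pi_int (m : int) : expi (2 * pi * m%:~R) = 1 :> C.
Proof.
have E (n : nat) : expi (2 * pi * n%:R) = 1 :> C.
  elim: n => [|n IH]; first by rewrite mulr0 expi0.
  rewrite (_ : n.+1%:R = n%:R + 1); last by rewrite -natr1.
  rewrite (mulrDr (2 * pi)) expiD IH mulr1 mul1r /expi.
  by rewrite (_ : 2 * pi = pi *+ 2 :> R) ?cos2pi ?sin2pi // mulr_natl.
by case: m => n; rewrite ?NegzE ?mulrNz ?mulrN ?expiN ?E ?invr1 //; exact: E.
Qed.

Lemma expi_frac x : expi (2 * pi * Defs.frac x) = expi (2 * pi * x) :> C.
Proof. by rewrite /Defs.frac mulrBr expiD expiN expi2pi_int invr1 mulr1. Qed.

Lemma frac_itv x : 0 <= Defs.frac x < 1.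
Proof.
by have := Num.Theory.floor_itv x; rewrite /Defs.frac intrD; lra.
Qed.

Lemma expi_eq1 x : 0 <= x < 1 -> expi (- (2 * pi * x)) = 1 :> C -> x = 0.
Proof.
move=> /andP[x0 x1] [hc _]; apply/eqP; case: eqP => // /eqP xn.
have px := pi_gt0 R; have xp : 0 < x by rewrite lt0r xn.
have : 0 < sin (pi * x).
  by apply: sin_gt0_pi; rewrite mulr_gt0//= -[ltRHS]mulr1 ltr_pM2l.
have : sin (pi * x) ^+ 2 = 0.
  move: hc; rewrite cosN (_ : 2 * pi * x = (pi * x) *+ 2); last by rewrite -mulr_natl; ring.
  by rewrite cos_mulr2n cos2sin2 => h; lra.
by move/eqP; rewrite sqrf_eq0 => /eqP ->; rewrite ltxx.
Qed.

Lemma expi_eqN1 x : 0 <= x < 1 -> expi (- (2 * pi * x)) = - 1 :> C -> x = 1 / 2.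
Proof.
move=> /andP[x0 x1] [hc _]; have px := pi_gt0 R.
have : cos (pi * x) ^+ 2 = 0.
  move: hc; rewrite cosN (_ : 2 * pi * x = (pi * x) *+ 2); last by rewrite -mulr_natl; ring.
  by rewrite cos_mulr2n => h; lra.
move/eqP; rewrite sqrf_eq0 => /eqP h.
have := @cos_inj R (pi * x) (pi / 2); rewrite h cos_pihalf !in_itv /= => /(_ _ _ erefl) e.
apply: (mulfI (lt0r_neq0 px)); rewrite e ?mul1r //.
  by rewrite mulr_ge0 ?(ltW px)//= -[leRHS]mulr1 ler_pM2l// ltW.
by lra.
Qed.

Lemma expi_half : expi (- (2 * pi * (1 / 2))) = - 1 :> C.
Proof.
rewrite (_ : 2 * pi * (1 / 2) = pi :> R); last by field.
rewrite expiN /expi cospi sinpi (_ : Complex (-1) 0 = -1 :> C) ?invrN ?invr1 //.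
by apply/eqP; rewrite eq_complex /= oppr0 !eqxx.
Qed.

(** An admissible angle exists, so [xget] does not fall back on its default for [z != 0]: it is
    [acos x] or [2 * pi - acos x], according to the sign of the imaginary part. *)
Lemma cargP (z : C) : z = `|z| * expi (carg z).
Proof.
case: (eqVneq z 0) => [->|z0]; first by rewrite normr0 mul0r.
suff : exists t : R, 0 <= t < 2 * pi /\ z = `|z| * expi t by move=> /(xgetPex 0)[].
pose w := z / `|z|; have n0 : `|z| != 0 by rewrite normr_eq0.
have w1 : `|w| = 1 by rewrite normf_div normr_id mulfV.
have zw : z = `|z| * w by rewrite mulrC divfK.
move: w1 zw; case: w => x y; rewrite normc_def /= => -[h] zw.
have {}h : x ^+ 2 + y ^+ 2 = 1.
  by rewrite -[LHS]sqr_sqrtr ?h ?expr1n// addr_ge0 ?sqr_ge0.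
have xb : -1 <= x <= 1 by have := sqr_ge0 y; nra.
have [/andP[a0 a1] ca] := acos_def xb.
have sa : sin (acos x) = `|y|.
  by rewrite sin_acos// -(_ : y ^+ 2 = 1 - x ^+ 2) ?sqrtr_sqr//; lra.
have px := pi_gt0 R.
case: (leP 0 y) => hy.
  exists (acos x); split; first by lra.
  by rewrite /expi ca sa ger0_norm.
exists (2 * pi - acos x); split.
  have : acos x != 0.
    apply/negP => /eqP e; move: sa; rewrite e sin0 => /esym/eqP.
    by rewrite normr_eq0 => /eqP e'; rewrite e' ltxx in hy.
  move=> hn; have : 0 < acos x by rewrite lt0r hn a0.
  by lra.
rewrite expiD; have := expi2pi_int 1; rewrite mulr1 => ->.
by rewrite mul1r /expi cosN sinN ca sa ltr0_norm// opprK.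
Qed.
End Expi.

(** * The spectral decimation theorem *)

Section Bridge.
Variable R : realType.
Local Notation C := R[i].
Implicit Types al be l : R.
Local Notation ph x := (expi (- (2 * pi * x)) : C).
Local Notation sp l := ((4 * (1 - l))%:C : C).
Local Ltac nz := repeat (apply/andP; split); by rewrite ?mulf_neq0 ?expf_neq0 ?oppr_eq0 ?oner_neq0 ?invr_eq0 ?expi_neq0.

Let RCM (x y : R) : (x * y)%:C = x%:C * y%:C. Proof. exact: rmorphM. Qed.
Let RCD (x y : R) : (x + y)%:C = x%:C + y%:C. Proof. exact: rmorphD. Qed.
Let RCN (x : R) : (- x)%:C = - x%:C. Proof. exact: rmorphN. Qed.
Let RCX (x : R) n : (x ^+ n)%:C = x%:C ^+ n. Proof. exact: rmorphXn. Qed.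
Let RCV (x : R) : (x^-1)%:C = x%:C^-1. Proof. exact: fmorphV. Qed.
Let RCn n : (n%:R : R)%:C = n%:R. Proof. exact: rmorph_nat. Qed.
Let RC := (RCn, RCX, RCV, RCM, RCD, RCN).

Lemma conn_fluxes al be om : is_connection al be om -> fluxes (ph al) (ph be) om.
Proof.
case=> H [U D]; split.
- move=> p q /H [h1 ->]; rewrite unit_conj // mulfV //.
  by rewrite -normr_eq0 h1 oner_neq0.
- move=> x y; rewrite expiN invrK -(U (x, y)) /shift /=.
  by rewrite !addr0.
- move=> x y; rewrite expiN invrK -(D (x, y)) /shift /=.
  by rewrite !addr0.
Qed.

Lemma mid_detE be l : mid_det (sp l) (ph be) = (64 * Df be l)%:C.
Proof.
rewrite /mid_det /Df expiN invrK; have := cos_expi (2 * pi * be); have := expi_neq0 (2 * pi * be).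
move: (cos _) (expi _) => c w w0 hc; rewrite !RC hc; field; nz.
Qed.

Lemma corner_coefE al be l : corner_coef (ph al) (ph be) (sp l) = (2 * Af al be l)%:C.
Proof.
have E : expi (2 * pi * (al + be)) = expi (2 * pi * al) * expi (2 * pi * be) :> C.
  by rewrite -expiD; congr expi; ring.
have := cos_expi (2 * pi * (al + be)); have := cos_expi (2 * pi * al).
rewrite /corner_coef /Af E !expiN; move: (expi_neq0 (2 * pi * al)) (expi_neq0 (2 * pi * be)).
move: (cos _) (cos _) (expi _) (expi _) => c c' w w' w0 w0' hc hc'; rewrite !RC hc hc'; field; nz.
Qed.

Lemma psi_polyE al be l : psi_poly (sp l) (ph al) (ph be) = 16 * Psi al be l.
Proof.
rewrite /psi_poly /Psi.
have -> : ph (2 * al + be) = ph al ^+ 2 * ph be by rewrite expr2 -!expiD; congr expi; ring.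
have -> : ph (al + be) = ph al * ph be by rewrite -!expiD; congr expi; ring.
have -> : expi (- (4 * pi * al)) = ph al ^+ 2 by rewrite expr2 -!expiD; congr expi; ring.
by move: (ph al) (ph be) => a b; rewrite !RC; field.
Qed.

Lemma psi_poly_conj al be l :
  psi_poly (sp l) (ph al)^-1 (ph be)^-1 = ((psi_poly (sp l) (ph al) (ph be))^*)%R.
Proof.
have : ((sp l)^*)%R = sp l by apply/conj_Creal/complex_realP; exists (4 * (1 - l)).
by move=> hs; rewrite (rmorph_psi_poly (Num.conj : {rmorphism C -> C})) /= hs !conj_expi.
Qed.

Lemma psi_poly_polar al be l : let rho := 16 * `|Psi al be l| in let z := expi (carg (Psi al be l)) in
  psi_poly (sp l) (ph al) (ph be) = rho * z /\ psi_poly (sp l) (ph al)^-1 (ph be)^-1 = rho / z.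
Proof.
have E : psi_poly (sp l) (ph al) (ph be) = 16 * `|Psi al be l| * expi (carg (Psi al be l)).
  by rewrite psi_polyE {1}(cargP (Psi al be l)) mulrA.
split=> //; rewrite psi_poly_conj E [LHS]rmorphM /= conj_expi; congr (_ / _).
by apply/conj_Creal; rewrite realM ?normr_real ?realn.
Qed.

(** With [z] of angle [2 * pi * theta], the factors [z ^+ 3] give the terms [3 * theta]; [expi] does
    not see the reduction modulo 1. *)
Lemma adown_fluxes al be om l : fluxes (ph al) (ph be) om ->
  fluxes (ph (adown al be l)) (ph (bdown al be l)) (coarse om (expi (carg (Psi al be l)))).
Proof.
move=> H; have := coarse_fluxes (expi_neq0 _) (expi_neq0 _) (expi_neq0 (carg (Psi al be l))) H.
have px := lt0r_neq0 (pi_gt0 R).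
have tq : carg (Psi al be l) = 2 * pi * theta al be l by
  rewrite /theta mulrC divfK // mulf_neq0 ?pnatr_eq0.
congr fluxes.
- rewrite [RHS]expiN /adown expi_frac -[RHS]expiN tq.
  transitivity (ph al * ph al * ph al * ph be * (ph (theta al be l) * ph (theta al be l) * ph (theta al be l))).
    by rewrite !(expiN (_ * theta _ _ _)); field; nz.
  by rewrite -!expiD; congr expi; ring.
- rewrite [RHS]expiN /bdown expi_frac -[RHS]expiN tq.
  by rewrite !exprS expr0 !mulr1 -!expiD; congr expi; ring.
Qed.

Lemma in_specE N (om : int * int -> int * int -> C) z : in_spec N om z <-> (0 < mult N om z)%N.
Proof. by rewrite /in_spec /mult /eigenvalue lt0n mxrank_eq0. Qed.

Lemma Re_norm (w : C) : `|w| = (complex.Re `|w|)%:C.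
Proof. by rewrite RRe_real ?normr_real. Qed.

Lemma mult_regular (conn : R -> R -> int * int -> int * int -> C) al be l N :
  (forall a b : R, 0 <= a < 1 -> 0 <= b < 1 -> is_connection a b (conn a b)) ->
  0 <= al < 1 -> 0 <= be < 1 -> ~ Eset al be l ->
  mult N.+1 (conn al be) l%:C =
  mult N (conn (adown al be l) (bdown al be l)) (Rf al be l)%:C.
Proof.
move=> Hc Ha Hb nE.
have H := conn_fluxes (Hc _ _ Ha Hb).
have H' := adown_fluxes l H.
have H'' := conn_fluxes (Hc _ _
  (frac_itv (3 * al + be + 3 * theta al be l))
  (frac_itv (3 * be + al - 3 * theta al be l))).
rewrite -/(adown _ _ _) -/(bdown _ _ _) in H''.
(* The coarse connection and the chosen one have equal fluxes, so they differ by a gauge. *)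
have [g g0 hg] := fluxes_gauge (expi_neq0 _) (expi_neq0 _) H' H''.
have D0 : mid_det (sp l) (ph be) != 0.
  rewrite mid_detE; apply/eqP => -[h]; apply: nE; right; lra.
have [P1 P2] := psi_poly_polar al be l.
have n0 : complex.Re `|Psi al be l| != 0.
  apply/eqP => h; apply: nE; left; apply/eqP; rewrite -normr_eq0 Re_norm h //.
apply: (mult_renorm (expi_neq0 _) (expi_neq0 _) H D0 (expi_neq0 _) P1 P2 _ g0).
  by rewrite !RC.
move=> h; rewrite eigenspace_rowf /eigfun.
set om' := conn (adown _ _ _) _.
have E p : (2 * ncell C N p * (1 - (Rf al be l)%:C) * (g p * h p) = nbsum N (fun q => om' p q * (g q * h q)) p) <->
    ncell C N p * (sp l / 2 * mid_det (sp l) (ph be) - corner_coef (ph al) (ph be) (sp l)) * h p =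
    16 * `|Psi al be l| * nbsum N (fun q => coarse (conn al be) (expi (carg (Psi al be l))) p q * h q) p.
  rewrite hg mid_detE corner_coefE Re_norm.
  (* This identity is what dictates the formula for [Rf]. *)
  have -> : sp l / 2 * (64 * Df be l)%:C - (2 * Af al be l)%:C =
     16 * (complex.Re `|Psi al be l|)%:C * (2 * (1 - (Rf al be l)%:C)).
    rewrite /Rf; set r := complex.Re _ in n0 *.
    have r0 : r%:C != 0 :> C by apply/eqP => -[/eqP]; apply/negP.
    move: r n0 r0 (Af _ _ _) (Df _ _) => r n0 r0 A D.
    by rewrite !RC; field.
  have r0 : 16 * (complex.Re `|Psi al be l|)%:C != 0 :> C.
    by rewrite mulf_neq0 ?pnatr_eq0 //; apply/eqP => -[/eqP]; apply/negP.
  split=> e.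
    have e' : 2 * ncell C N p * (1 - (Rf al be l)%:C) * h p =
      nbsum N (fun q => coarse (conn al be) (expi (carg (Psi al be l))) p q * h q) p.
      by apply: (mulfI (g0 p)); rewrite -e; ring.
    by rewrite -e'; ring.
  transitivity (g p * (2 * ncell C N p * (1 - (Rf al be l)%:C) * h p)); first by ring.
  by congr (_ * _); apply: (mulfI r0); rewrite -e; ring.
by split=> h' p; apply/E; apply: h'.
Qed.

(** The solutions of [s = - 2 a] with [a = 1] and [a = -1]. *)
Definition exceptional al l := (al = 0 /\ l = 3 / 2) \/ (al = 1 / 2 /\ l = 1 / 2).

Lemma expi_phase0 : ph 0 = 1.
Proof. by rewrite mulr0 oppr0 expi0. Qed.

Lemma exceptional_of_Psi0 al be l : 0 <= al < 1 -> Df be l <> 0 -> Psi al be l = 0 -> exceptional al l.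
Proof.
move=> Ha D P.
have P1 : psi_poly (sp l) (ph al) (ph be) = 0 by rewrite psi_polyE P mulr0.
have P2 : psi_poly (sp l) (ph al)^-1 (ph be)^-1 = 0 by rewrite psi_poly_conj P1 rmorph0.
have D0 : mid_det (sp l) (ph be) != 0.
  rewrite mid_detE; apply/eqP => -[h]; apply: D; lra.
(* The phase has modulus 1, so it is neither 2 nor -2. *)
have far (x : C) : `|x| = 2 -> ph al != x.
  move=> h; apply/eqP => e; have := norm_expi (- (2 * pi * al)); rewrite e h => /eqP.
  by rewrite (_ : 1 = 1%:R) // eqr_nat.
have far2 : 2 + ph al != 0 by rewrite addrC addr_eq0 far // normrN normr_nat.
have far2' : ph al != 2 by rewrite far // normr_nat.
have [+ hs] := psi_poly_eq0 (expi_neq0 _) (expi_neq0 _) far2 far2' D0 P1 P2.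
case=> ha; rewrite ha in hs.
  left; split; first exact: expi_eq1.
  by move: hs; rewrite mulr1 => -[]; lra.
right; split; first exact: expi_eqN1.
by move: hs; rewrite mulrN1 opprK => -[]; lra.
Qed.

Lemma exceptional_Psi al be l : exceptional al l -> Psi al be l = 0.
Proof.
move=> h; apply: (mulfI (_ : 16 != 0 :> C)); first by rewrite pnatr_eq0.
rewrite mulr0 -psi_polyE /psi_poly; case: h => -[-> ->].
  by rewrite expi_phase0 !RC; field.
by rewrite expi_half !RC; field.
Qed.

(** At [s = -2] the determinant is [- (b + 1)^2 / b], at [s = 2] it is [- (b - 1)^2 / b]; a zero
    would force [be = 1/2] or [be = 0]. *)
Lemma exceptional_Df al be l : 0 <= be < 1 -> ~ ((al = 0 \/ al = 1 / 2) /\ (be = 0 \/ be = 1 / 2)) ->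
  exceptional al l -> Df be l <> 0.
Proof.
move=> Hb nab h D; apply: nab; have := mid_detE be l; rewrite D mulr0 /mid_det.
have b0 := expi_neq0 (- (2 * pi * be)).
case: h => -[-> ->]; rewrite !RC => e;
  split; [by left | right | by right | left].
  apply: expi_eqN1 => //; apply/eqP; rewrite -addr_eq0 -sqrf_eq0; apply/eqP.
  transitivity (- ph be * ((4 * (1 - 3 / 2)) ^+ 3 - 3 * (4 * (1 - 3 / 2)) - ph be - (ph be)^-1)).
    by field.
  by rewrite e mulr0.
apply: expi_eq1 => //; apply/eqP; rewrite -subr_eq0 -sqrf_eq0; apply/eqP.
transitivity (- ph be * ((4 * (1 - 1 / 2)) ^+ 3 - 3 * (4 * (1 - 1 / 2)) - ph be - (ph be)^-1)).
  by field.
by rewrite e mulr0.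
Qed.

(** Both the diagonal coefficient and [rho] vanish, so every function on the coarse vertices extends
    to an eigenfunction. *)
Lemma mult_exceptional om al be l N : is_connection al be om -> Df be l <> 0 -> exceptional al l ->
  mult N.+1 om l%:C = #|{: VT N}|.
Proof.
move=> /conn_fluxes H D S.
have D0 : mid_det (sp l) (ph be) != 0.
  rewrite mid_detE; apply/eqP => -[h]; apply: D; lra.
have [P1 P2] := psi_poly_polar al be l; rewrite (exceptional_Psi be S) normr0 mulr0 in P1 P2.
rewrite -[RHS](mxrank1 C).
apply: (mult_renorm (expi_neq0 _) (expi_neq0 _) H D0 (expi_neq0 _) P1 P2 _ (g := fun=> 1)).
- by rewrite !RC.
- by move=> p; exact: oner_neq0.
- move=> h; rewrite submx1; split=> // _ p; rewrite mul0r.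
  rewrite (_ : _ - _ = 0) ?mulr0 ?mul0r //.
  have b0 := expi_neq0 (- (2 * pi * be)).
  rewrite /mid_det /corner_coef; case: S => -[-> ->].
    by rewrite expi_phase0 !RC; field.
  by rewrite expi_half !RC; field.
Qed.
End Bridge.

(** * Spectrum, disjointness and multiplicities put together *)

Unset Implicit Arguments.
Set Strict Implicit.
Set Printing Implicit Defensive.

Theorem theorem1p5 (R : realType)
  (conn : R -> R -> int * int -> int * int -> R[i])
  (Hconn : forall a b : R, 0 <= a < 1 -> 0 <= b < 1 -> is_connection a b (conn a b))
  (alpha beta : R) (Ha : 0 <= alpha < 1) (Hb : 0 <= beta < 1)
  (Hnot : ~ ((alpha = 0 \/ alpha = 1 / 2) /\ (beta = 0 \/ beta = 1 / 2)))
  (N : nat) (HN : (1 <= N)%N) :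
  let S1 := fun l : R => ~ Eset alpha beta l /\
      in_spec N.-1 (conn (adown alpha beta l) (bdown alpha beta l))
              (Rf alpha beta l)%:C in
  let S2 := fun l : R => Df beta l = 0 /\ in_spec N (conn alpha beta) l%:C in
  let S3 := fun l : R => (alpha = 0 /\ l = 3 / 2) \/ (alpha = 1 / 2 /\ l = 1 / 2) in
  (forall z : R[i], in_spec N (conn alpha beta) z <->
     exists l : R, z = l%:C /\ (S1 l \/ S2 l \/ S3 l)) /\
  (forall l : R, ~ (S1 l /\ S2 l) /\ ~ (S1 l /\ S3 l) /\ ~ (S2 l /\ S3 l)) /\
  (forall l : R, S1 l ->
     mult N (conn alpha beta) l%:C =
     mult N.-1 (conn (adown alpha beta l) (bdown alpha beta l)) (Rf alpha beta l)%:C) /\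
  (forall l : R, S3 l -> mult N (conn alpha beta) l%:C = ((3 ^ N + 3) %/ 2)%N).
Proof.
move=> S1 S2 S3.
case: N HN @S1 @S2 => // N _ S1 S2.
have M1 l : ~ Eset alpha beta l -> mult N.+1 (conn alpha beta) l%:C =
    mult N (conn (adown alpha beta l) (bdown alpha beta l)) (Rf alpha beta l)%:C.
  exact: mult_regular.
have M3 l : S3 l -> mult N.+1 (conn alpha beta) l%:C = ((3 ^ N.+1 + 3) %/ 2)%N.
  move=> h; rewrite -card_VT; apply: (mult_exceptional (al := alpha) (be := beta)) => //.
    exact: Hconn.
  exact: exceptional_Df h.
split; [|split; [|split]].
- move=> z; split.
    move=> hz; have [l el] : exists l : R, z = l%:C.
      apply: spec_real hz => p q h.
      by have [H _] := Hconn _ _ Ha Hb; exact: H.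
    exists l; split=> //; rewrite el in hz.
    (* An eigenvalue falls in [S2] if [Df] vanishes, otherwise in [S3] or [S1] according to whether
       [Psi] vanishes. *)
    have [D|D] := pselect (Df beta l = 0); first by right; left.
    have [P|P] := pselect (Psi alpha beta l = 0).
      by right; right; exact: exceptional_of_Psi0 P.
    by left; split; [case | apply/in_specE; rewrite -M1 /Eset; [apply/in_specE|case]].
  case=> l [-> [[h1 h2]|[[_ h2]|h3]]] //; apply/in_specE.
    by rewrite M1 //; apply/in_specE.
  by rewrite M3 // divn_gt0 // addn3.
- move=> l; split; first by case=> -[h _] [h' _]; apply: h; right.
  split; first by case=> -[h _] h'; apply: h; left; exact: exceptional_Psi h'.
  by case=> -[h _] h'; exact: (exceptional_Df Hb Hnot h') h.
- by move=> l [h _]; exact: M1.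
- exact: M3.
Qed.
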